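(* Let $\Gamma$ be a plumbing graph with linking matrix $W$ satisfying the standing assumptions, and let $k$ be a positive integer. For $\mathbf t=(t_v)_{v\in V_{\ge2}}$ consider the meromorphic function $$F(\mathbf t)=\frac{\mathbf e(|V_{\ge2}|/8)}{\sqrt{2k}^{\,|V_{\ge2}|}\prod_{i\in V_1}\sqrt{|w_i|}}\sum_{\mu\in\mathbb Z^{V_{\ge2}}/2kS(\mathbb Z^{V_{\ge2}})}\mathbf e\left(-\frac1{4k}{}^t\mu S^{-1}\mu\right)\prod_{v\in V_{\ge2}}G_v\left(\zeta_{2kM_v}^{\mu_v}e^{-t_v/2M_v}\right).$$ (1) For each vertex $v\in V_{\ge3}$, the order of $F(\mathbf t)$ at $t_v=0$ satisfies $$\mathrm{ord}_{t_v=0}F(\mathbf t)\ge\min\{0,\ |\overline v|+2-\deg(v)\}.$$ (2) If $|\overline v|+2-\deg(v)>0$ for each vertex $v\in V_{\ge3}$, then $F(\mathbf t)$ is holomorphic at $\mathbf t=0$ and $$F(0)=\frac{\mathbf e(|V_{\ge2}|/8)}{\sqrt{2k}^{\,|V_{\ge2}|}\prod_{i\in V_1}\sqrt{|w_i|}}\sum_{\mu\in(\mathbb Z\setminus k\mathbb Z)^{V_{\ge2}}/2kS(\mathbb Z^{V_{\ge2}})}\mathbf e\left(-\frac1{4k}{}^t\mu S^{-1}\mu\right)\prod_{v\in V_{\ge2}}G_v\left(\zeta_{2kM_v}^{\mu_v}\right).$$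
   Context: $\mathbf e(z)=e^{2\pi iz}$, $\zeta_m=e^{2\pi i/m}$ for a nonzero integer $m$. A plumbing graph $\Gamma=(V,E,(w_v)_{v\in V})$ is a finite tree with weights $w_v\in\mathbb Z$. Its linking matrix $W$ is the symmetric $V\times V$ integer matrix with $W_{vv}=w_v$, $W_{vv'}=1$ if $\{v,v'\}\in E$, and $0$ for other $v\ne v'$. Standing assumptions: $|V|\ge2$, $W$ is negative definite, $\det W=\pm1$, and $w_i\le-2$ for every vertex $i$ of degree $1$. $V_1$ is the set of vertices of degree $1$, $V_{\ge d}$ the set of vertices of degree $\ge d$. For $v\in V_{\ge2}$: $\overline v=\{i\in V_1\mid\{i,v\}\in E\}$, $M_v=\prod_{i\in\overline v}w_i$ ($=1$ if $\overline v=\emptyset$), and $$G_v(q)=(q^{M_v}-q^{-M_v})^{2-\deg(v)}\prod_{i\in\overline v}\left(q^{M_v/w_i}-q^{-M_v/w_i}\right).$$ $S$ is the $V_{\ge2}\times V_{\ge2}$ submatrix of $-W^{-1}$ (each summand in $F$ depends only on the class of $\mu$ modulo $2kS(\mathbb Z^{V_{\ge2}})$). $\mathrm{ord}_{t_v=0}$ denotes the order of vanishing (negative for poles) of a meromorphic function along the divisor $\{t_v=0\}$ near the origin, with the convention $\mathrm{ord}\,0=+\infty$. *)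

(* Defs.v *)
From HB Require Import structures.
From mathcomp Require Import all_boot all_order all_algebra.
From mathcomp Require Import complex.
From mathcomp Require Import all_classical all_reals all_analysis.

Set Implicit Arguments.
Unset Strict Implicit.
Unset Printing Implicit Defensive.

Import Order.TTheory GRing.Theory Num.Theory.
Import numFieldNormedType.Exports.

Local Open Scope ring_scope.
Local Open Scope complex_scope.

Section ComplexExponential.
Variable R : realType.

Definition cexp (z : R[i]) : R[i] :=
  (expR (complex.Re z))%:C * (cos (complex.Im z) +i* sin (complex.Im z)).

Definition ee (z : R[i]) : R[i] := cexp (2 * (pi : R)%:C * 'i * z).

Definition zeta (m : int) : R[i] := ee (m%:~R)^-1.

End ComplexExponential.

(* Germs at the origin of functions of n complex variables.  Meromorphic
   functions are represented by total functions [f : 'rV[R[i]^o]_n -> R[i]]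
   whose values on a proper analytic subset (in particular along the poles,
   where division is given a default value) carry no information: two of them
   represent the same germ when they satisfy [germ_eq]. *)
Section MeromorphicGerms.
Local Open Scope classical_set_scope.
Variables (R : realType) (n : nat).
Implicit Types f g h d : 'rV[R[i]^o]_n -> R[i].

Definition holomorphic0 f : Prop :=
  \forall t \near (0 : 'rV[R[i]^o]_n), differentiable (f : _ -> R[i]^o) t.

Definition germ_eq f g : Prop :=
  exists d, [/\ holomorphic0 d,
    ~ (\forall t \near (0 : 'rV[R[i]^o]_n), d t = 0) &
    \forall t \near (0 : 'rV[R[i]^o]_n), d t != 0 -> f t = g t].

(* [f] belongs to [t_a ^ m * O], where [O] is the localization of the ring of
   holomorphic germs at its prime ideal generated by [t_a]. *)
Definition in_power_along (a : 'I_n) (m : int) f : Prop :=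
  exists g h, [/\ holomorphic0 g, holomorphic0 h,
    ~ (\forall t \near (0 : 'rV[R[i]^o]_n),
        (t : 'rV[R[i]^o]_n) 0 a = 0 -> h t = 0) &
    germ_eq f (fun t : 'rV[R[i]^o]_n => (t 0 a : R[i]) ^ m * (g t / h t))].

(* The valuation of the discrete valuation ring [O] above; it is [+oo] exactly
   on the zero germ, and [-oo] if [f] does not represent a meromorphic germ. *)
Definition ord_along (a : 'I_n) f : \bar R :=
  ereal_sup [set (m%:~R)%:E | m in [set m : int | in_power_along a m f]].

(* The germ [f] is holomorphic at the origin, with value [z] there. *)
Definition holomorphic_with_value f (z : R[i]) : Prop :=
  exists g, [/\ holomorphic0 g, germ_eq f g & g 0 = z].

End MeromorphicGerms.

Record plumbing (V : finType) := Plumbing {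
  adj : rel V;
  weight : V -> int;
  adj_sym : symmetric adj;
  adj_irrefl : irreflexive adj;
  adj_connected : forall u v, connect adj u v;
  adj_acyclic : forall c : seq V, (2 < size c)%N -> ~ ucycle adj c
}.

Section Plumbing.
Variables (V : finType) (G : plumbing V).

Definition deg (v : V) : nat := #|[set u | adj G v u]|.

Definition leaves : {set V} := [set v | deg v == 1]%N.

Definition V2 : {set V} := [set v | 2 <= deg v]%N.

Definition linking : 'M[int]_#|V| :=
  \matrix_(i, j) if i == j then weight G (enum_val i)
                 else (adj G (enum_val i) (enum_val j))%:R.

Definition negative_definite (R : realType) (m : nat) (A : 'M[int]_m) : Prop :=
  forall x : 'cV[R]_m, x != 0 -> (x^T *m map_mx intr A *m x) 0 0 < 0.

Definition leaf_nbrs (v : V) : {set V} := [set i in leaves | adj G i v].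

Definition Mint (v : V) : int := \prod_(i in leaf_nbrs v) weight G i.

(* The index set [V2] is numbered by ['I_#|V2|]. *)
Definition vtx (a : 'I_#|V2|) : V := enum_val a.

(* The determinant of [linking] is assumed to be 1 or -1, so that its inverse
   is an integer matrix and [invmx] can be taken over [int]. *)
Definition Smx : 'M[int]_#|V2| :=
  mxsub (fun a => enum_rank (vtx a)) (fun a => enum_rank (vtx a))
    (- invmx linking).

(* The divisions [Mint v %/ weight G i] are exact. *)
Definition Gfun (R : realType) (v : V) (q : R[i]) : R[i] :=
  (q ^ Mint v - q ^ (- Mint v)) ^ (2 - (deg v)%:Z) *
  \prod_(i in leaf_nbrs v)
     (q ^ (Mint v %/ weight G i)%Z - q ^ (- (Mint v %/ weight G i)%Z)).

Section Sum.
Local Open Scope classical_set_scope.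
Variable k : nat.

Definition class_of (mu : 'cV[int]_#|V2|) : set 'cV[int]_#|V2| :=
  [set mu + (2 * k)%:Z *: (Smx *m x) | x in [set: 'cV[int]_#|V2|]].

(* Sum over the image of [A] in Z^V2 / 2kS(Z^V2); each class is represented by
   an arbitrary one of its elements. *)
Definition sum_classes (R : realType) (A : set 'cV[int]_#|V2|)
    (f : 'cV[int]_#|V2| -> R[i]) : R[i] :=
  \sum_(c \in [set class_of mu | mu in A]) f (xget 0 c).

Definition prefactor (R : realType) : R[i] :=
  ee (#|V2|%:R / 8) /
  ((Num.sqrt (2 * k)%:R : R)%:C ^+ #|V2| *
   \prod_(i in leaves) (Num.sqrt (`|weight G i|%:~R) : R)%:C).

Definition gauss_phase (R : realType) (mu : 'cV[int]_#|V2|) : R[i] :=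
  let muC := map_mx intr mu in
  ee (- (4 * k)%:R^-1 * (muC^T *m invmx (map_mx intr Smx) *m muC) 0 0).

Definition Ffun (R : realType) (t : 'rV[R[i]^o]_#|V2|) : R[i] :=
  prefactor R *
  sum_classes setT (fun mu => gauss_phase R mu *
    \prod_(a < #|V2|)
      Gfun (vtx a) (zeta R ((2 * k)%:Z * Mint (vtx a)) ^ (mu a 0) *
                    cexp (- t 0 a / (2 * (Mint (vtx a))%:~R)))).

Definition F0_rhs (R : realType) : R[i] :=
  prefactor R *
  sum_classes [set mu : 'cV[int]_#|V2| | forall a, ~~ (k%:Z %| mu a 0%R)%Z]
    (fun mu => gauss_phase R mu *
    \prod_(a < #|V2|)
      Gfun (vtx a) (zeta R ((2 * k)%:Z * Mint (vtx a)) ^ (mu a 0))).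

End Sum.
End Plumbing.

(* Main.v *)
Require Import Defs.
From mathcomp Require Import all_boot all_order all_algebra.
From mathcomp Require Import complex ring lra zify.
From mathcomp Require Import all_classical all_reals all_analysis.

Set Implicit Arguments.
Unset Strict Implicit.
Unset Printing Implicit Defensive.

Import Order.TTheory GRing.Theory Num.Theory.
Import numFieldNormedType.Exports.
Local Open Scope ring_scope.

(* Since W is unimodular, the weights of the leaves at a common vertex v are
   pairwise coprime and S(Z^V2) is the product of the M_v Z, so that F is a sum
   over the box of all mu with each mu_v taken modulo 2 k M_v.  For q = e^z,
   q^n - q^-n = 2 sinh (n z), and the center factor of G_v has a pole at t_v = 0
   exactly when k | mu_v.  For a leaf i at v choose u = -1 mod 2 w_i with
   u = 1 mod 2 w_j for the other leaves j at v: the involution mu_v -> u mu_v on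
   the terms with k | mu_v preserves the Gauss phase and all factors except that
   of i, so that this factor may be replaced by its mean over the involution,
   which is a multiple of sinh (t_v / 2 w_i).  Doing this for all leaves makes
   every term with k | mu_v of order at least 2 - deg v + |leaves at v| along
   t_v = 0, which gives (1).  In the situation of (2) this kills, at t = 0, the
   terms having k | mu_v for a vertex v with a leaf.  If v has none, then
   mu -> - mu on one branch at v preserves the phase when k | mu_v, and it
   reverses the sign of the product by the handshake parity, so that the terms
   with k | mu_v cancel. *)

(** * Functions complex differentiable near a point *)

Section NearDifferentiable.
Local Open Scope classical_set_scope.
Variables (K : numFieldType) (V : normedModType K) (x : V).
Implicit Types f g : V -> K^o.

(** At the origin of complex space this unfolds to [holomorphic0], so the closure properties below
    apply to holomorphic germs by conversion. *)
Definition diff_near f := \forall t \near x, differentiable f t.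

Lemma eq_diff_near f g : f =1 g -> diff_near f -> diff_near g.
Proof. by move=> /funext ->. Qed.

Lemma diff_nearW f : (forall t, differentiable f t) -> diff_near f.
Proof. by move=> df; apply: nearW. Qed.

Lemma diff_near_cst (c : K) : diff_near (fun=> c).
Proof. by apply: diff_nearW => t; exact: differentiable_cst. Qed.

Lemma diff_nearD f g :
  diff_near f -> diff_near g -> diff_near (fun t => f t + g t).
Proof. by apply: filterS2 => t; exact: differentiableD. Qed.

Lemma diff_nearM f g :
  diff_near f -> diff_near g -> diff_near (fun t => f t * g t).
Proof. by apply: filterS2 => t; exact: differentiableM. Qed.

Lemma diff_near_sum (I : Type) (r : seq I) (P : pred I) (F : I -> V -> K^o) :
  (forall i, P i -> diff_near (F i)) ->
  diff_near (fun t => \sum_(i <- r | P i) F i t).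
Proof.
move=> hF; elim: r => [|i r IHr].
  by apply: eq_diff_near (diff_near_cst 0) => t; rewrite big_nil.
case: (boolP (P i)) => [Pi|/negbTE nPi].
  by apply: eq_diff_near (diff_nearD (hF i Pi) IHr) => t; rewrite big_cons Pi.
by apply: eq_diff_near IHr => t; rewrite big_cons nPi.
Qed.

Lemma diff_near_prod (I : Type) (r : seq I) (P : pred I) (F : I -> V -> K^o) :
  (forall i, P i -> diff_near (F i)) ->
  diff_near (fun t => \prod_(i <- r | P i) F i t).
Proof.
move=> hF; elim: r => [|i r IHr].
  by apply: eq_diff_near (diff_near_cst 1) => t; rewrite big_nil.
case: (boolP (P i)) => [Pi|/negbTE nPi].
  by apply: eq_diff_near (diff_nearM (hF i Pi) IHr) => t; rewrite big_cons Pi.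
by apply: eq_diff_near IHr => t; rewrite big_cons nPi.
Qed.

Lemma diff_nearX f n : diff_near f -> diff_near (fun t => f t ^+ n).
Proof.
move=> hf; elim: n => [|n IHn].
  exact: eq_diff_near (diff_near_cst 1) => t.
by apply: eq_diff_near (diff_nearM hf IHn) => t; rewrite exprS.
Qed.

Lemma diff_near_neq0 f : diff_near f -> f x != 0 -> \forall t \near x, f t != 0.
Proof.
move=> /nbhs_singleton hf fx0.
exact: cvgr_neq0 (differentiable_continuous hf) fx0.
Qed.

Lemma diff_nearV f :
  diff_near f -> f x != 0 -> diff_near (fun t => (f t)^-1).
Proof.
move=> hf fx0; have := diff_near_neq0 hf fx0; move: hf.
by apply: filterS2 => t dft ft0; exact: differentiableV.
Qed.

Lemma diff_nearXz f (m : int) :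
  diff_near f -> f x != 0 -> diff_near (fun t => f t ^ m).
Proof.
move=> hf fx0; case: m => n; first exact: diff_nearX.
apply: diff_nearV; first exact: diff_nearX.
by rewrite expf_neq0.
Qed.

End NearDifferentiable.

Lemma diff_near_comp (K : numFieldType) (V W : normedModType K) (x : V)
    (g : V -> W) (f : W -> K^o) :
  (forall t, differentiable g t) -> diff_near (g x) f ->
  diff_near x (fun t => f (g t)).
Proof.
move=> dg df.
have : (\forall t \near x, differentiable f (g t))%classic.
  by have /(_ _ df) := differentiable_continuous (dg x).
by apply: filterS => t ft; exact: differentiable_comp.
Qed.

(** * The complex exponential *)

Section RealEstimates.
Variable R : realType.
Implicit Types x : R.

(** The mean value theorem between 0 and x gives |f x| = |f'(c)| |x| with |c| <= |x|. The Taylor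
    bounds below are obtained from it, each from a bound on the derivative. *)
Lemma le_powS_of_derive (f df : R -> R) (C : R) (n : nat) :
  (forall x, is_derive x 1 f (df x)) -> f 0 = 0 ->
  (forall x, `|x| <= 1 -> `|df x| <= C * `|x| ^+ n) ->
  forall x, `|x| <= 1 -> `|f x| <= C * `|x| ^+ n.+1.
Proof.
move=> fdf f0 dfC x x1.
have cf y z : {within `[y, z], continuous f}%classic.
  apply: continuous_subspaceT => t.
  by apply: differentiable_continuous; apply/derivable1_diffP; case: (fdf t).
have C0 : 0 <= C.
  by have := dfC 1; rewrite normr1 expr1n mulr1 => /(_ _)/(le_trans _); apply.
suff [c cx ->] : exists2 c, `|c| <= `|x| & `|f x| = `|df c| * `|x|.
  rewrite exprSr mulrA ler_wpM2r//.
  apply: le_trans (dfC _ (le_trans cx x1)) _.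
  by rewrite ler_wpM2l// lerXn2r// nnegrE.
have [x0|x0] := leP 0 x.
  have [c] := MVT_segment x0 (fun y _ => fdf y) (cf _ _).
  rewrite in_itv/= => /andP[c0 cx]; rewrite f0 !subr0 => fx.
  by exists c; [rewrite !ger0_norm//|rewrite fx normrM].
have [c] := MVT_segment (ltW x0) (fun y _ => fdf y) (cf _ _).
rewrite in_itv/= => /andP[xc c0]; rewrite f0 !sub0r => fx.
exists c; first by rewrite (ler0_norm c0) (ltr0_norm x0) lerN2.
by rewrite -normrN fx normrM normrN.
Qed.

Lemma expR_le1 x : `|x| <= 1 -> `|expR x| <= expR 1 :> R.
Proof. by rewrite ler_norml => /andP[_ x1]; rewrite ger0_norm ?expR_ge0// ler_expR. Qed.

Let e1 : R := expR 1.

Let de x : is_derive x 1 (fun t : R => expR (- t)) (- expR (- x)).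
Proof.
have := @is_derive1_comp R expR (-%R) x _ _ (is_derive_expR _) (is_deriveNid _ _).
by rewrite mulrN1.
Qed.

Lemma expRB1_le x : `|x| <= 1 -> `|expR x - 1| <= e1 * `|x| ^+ 1.
Proof.
apply: (@le_powS_of_derive (fun x => expR x - 1) expR) => [t||t t1].
- by apply: is_derive_eq; rewrite subr0.
- by rewrite expR0 subrr.
- by rewrite expr0 mulr1; exact: expR_le1.
Qed.

Lemma expRB1x_le x : `|x| <= 1 -> `|expR x - 1 - x| <= e1 * `|x| ^+ 2.
Proof.
apply: (@le_powS_of_derive (fun x => expR x - 1 - x) (fun x => expR x - 1)) => [t||t t1].
- by apply: is_derive_eq; rewrite subr0.
- by rewrite expR0 !subrr.
- exact: expRB1_le.
Qed.

Lemma expRBN_le x : `|x| <= 1 -> `|expR x - expR (- x)| <= 2 * e1 * `|x| ^+ 1.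
Proof.
apply: (@le_powS_of_derive (fun x => expR x - expR (- x))
  (fun x => expR x + expR (- x))) => [t||t t1].
- by apply: is_derive_eq; ring.
- by rewrite oppr0 subrr.
- rewrite expr0 mulr1 mulr_natl mulr2n; apply: le_trans (ler_normD _ _) _.
  by apply: lerD; apply: expR_le1; rewrite ?normrN.
Qed.

Lemma expRDN_le x : `|x| <= 1 -> `|expR x + expR (- x) - 2| <= 2 * e1 * `|x| ^+ 2.
Proof.
apply: (@le_powS_of_derive (fun x => expR x + expR (- x) - 2)
  (fun x => expR x - expR (- x))) => [t||t t1].
- by have := de t => dt; apply: is_derive_eq; rewrite subr0.
- by rewrite oppr0 expR0 subrr.
- exact: expRBN_le.
Qed.

Lemma expRBNx_le x :
  `|x| <= 1 -> `|expR x - expR (- x) - 2 * x| <= 2 * e1 * `|x| ^+ 3.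
Proof.
apply: (@le_powS_of_derive (fun x => expR x - expR (- x) - 2 * x)
  (fun x => expR x + expR (- x) - 2)) => [t||t t1].
- by have := de t => dt; apply: is_derive_eq; rewrite /GRing.scale/=; ring.
- by rewrite oppr0 subrr mulr0 subr0.
- exact: expRDN_le.
Qed.

Lemma sin_le1 x : `|x| <= 1 -> `|sin x| <= 1 * `|x| ^+ 1.
Proof.
apply: (@le_powS_of_derive sin cos) => [|t t1].
- by rewrite sin0.
- by rewrite expr0 mulr1 ler_norml cos_geN1 cos_le1.
Qed.

Lemma cosB1_le x : `|x| <= 1 -> `|cos x - 1| <= 1 * `|x| ^+ 2.
Proof.
apply: (@le_powS_of_derive (fun x => cos x - 1) (fun x => - sin x)) => [t||t t1].
- by apply: is_derive_eq; rewrite subr0.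
- by rewrite cos0 subrr.
- by rewrite normrN; exact: sin_le1.
Qed.

Lemma sinBx_le x : `|x| <= 1 -> `|sin x - x| <= 1 * `|x| ^+ 3.
Proof.
apply: (@le_powS_of_derive (fun x => sin x - x) (fun x => cos x - 1)) => [|t t1].
- by rewrite sin0 subrr.
- exact: cosB1_le.
Qed.

End RealEstimates.

(** * Complex exponential and hyperbolic sine: functional equations and Taylor bounds *)

Section ComplexExponential.
Variable R : realType.
Local Notation C := R[i].
Local Open Scope complex_scope.
Implicit Types z : C.

(** This is 2 sinh z, the shape of every factor of G_v in logarithmic coordinates. *)
Definition dsinh (z : C) : C := cexp z - cexp (- z).

Lemma cexpE (x y : R) :
  cexp (x +i* y) = (expR x * cos y) +i* (expR x * sin y).
Proof. by rewrite /cexp/=; simpc. Qed.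

Lemma cexpD z w : cexp (z + w) = cexp z * cexp w.
Proof.
case: z w => [x y] [u v].
have -> : (x +i* y) + (u +i* v) = (x + u) +i* (y + v) by [].
rewrite !cexpE expRD cosD sinD; simpc.
by congr (_ +i* _); ring.
Qed.

Lemma cexp0 : cexp 0 = 1 :> C.
Proof. by rewrite (cexpE 0 0) expR0 cos0 sin0 mulr1 mulr0. Qed.

Lemma cexpNl z : cexp (- z) * cexp z = 1.
Proof. by rewrite -cexpD addNr cexp0. Qed.

Lemma cexp_neq0 z : cexp z != 0.
Proof. by have /eqP := cexpNl z; apply: contraTneq => ->; rewrite mulr0 eq_sym oner_neq0. Qed.

Lemma cexpN z : cexp (- z) = (cexp z)^-1.
Proof. by apply: (mulIf (cexp_neq0 z)); rewrite cexpNl mulVf// cexp_neq0. Qed.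

Lemma cexpMn z n : cexp (z *+ n) = cexp z ^+ n.
Proof. by elim: n => [|n IHn]; rewrite ?cexp0// mulrS cexpD IHn exprS. Qed.

Lemma cexpMz z (m : int) : cexp (m%:~R * z) = cexp z ^ m.
Proof.
case: m => n; first by rewrite -pmulrn mulr_natl cexpMn.
by rewrite NegzE mulrNz mulNr -pmulrn mulr_natl cexpN cexpMn.
Qed.

Lemma dsinh0 : dsinh 0 = 0.
Proof. by rewrite /dsinh oppr0 subrr. Qed.

Lemma dsinhN z : dsinh (- z) = - dsinh z.
Proof. by rewrite /dsinh opprK opprB. Qed.

Lemma dsinhD z w :
  dsinh (z + w) = cexp z * cexp w - cexp (- z) * cexp (- w).
Proof. by rewrite /dsinh opprD !cexpD. Qed.

Lemma normC_le (a b : R) : `|a +i* b| <= (`|a| + `|b|)%:C.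
Proof.
rewrite {1}[_ +i* _]complexE/= rmorphD/=; apply: le_trans (ler_normD _ _) _.
by rewrite normrM !normc_def/= !expr0n/= !expr1n !addr0 !add0r sqrtr1 mul1r !sqrtr_sqr.
Qed.

(** Naming the modulus as a real r that dominates both coordinates turns the complex estimates into
    real inequalities. *)
Lemma normC_bounds (x y : R) : exists r : R,
  [/\ `|x +i* y| = r%:C, `|x| <= r, `|y| <= r & 0 <= r].
Proof.
exists (Num.sqrt (x ^+ 2 + y ^+ 2)); split; last exact: sqrtr_ge0.
- exact: normc_def.
- by rewrite -sqrtr_sqr ler_wsqrtr// lerDl sqr_ge0.
- by rewrite -sqrtr_sqr ler_wsqrtr// lerDr sqr_ge0.
Qed.

Lemma cexpB1z_le : exists2 c : R, 0 <= c &
  forall z, `|z| <= 1 -> `|cexp z - 1 - z| <= c%:C * `|z| ^+ 2.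
Proof.
have e0 : 0 <= expR 1 :> R := expR_ge0 _.
(* The constant is the sum of the bounds e + 2 for the real part and e + 1 for the imaginary part,
   where e = exp 1. *)
exists (2 * expR 1 + 3) => [|[x y]]; first by lra.
have [r [-> xr yr r0]] := normC_bounds x y.
rewrite -(rmorph1 (real_complex R)) lecR => r1.
have x1 := le_trans xr r1; have y1 := le_trans yr r1.
have -> : cexp (x +i* y) - 1 - (x +i* y) =
    (expR x * cos y - 1 - x) +i* (expR x * sin y - y).
  by rewrite cexpE; simpc.
apply: le_trans (normC_le _ _) _.
rewrite -rmorphXn -rmorphM/= lecR.
have r2x : `|x| ^+ 2 <= r ^+ 2 by rewrite lerXn2r// nnegrE.
have r2y : `|y| ^+ 2 <= r ^+ 2 by rewrite lerXn2r// nnegrE.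
have r32 : r ^+ 3 <= r ^+ 2 by rewrite ler_wiXn2l.
have r3y : `|y| ^+ 3 <= r ^+ 3 by rewrite lerXn2r// nnegrE.
have hRe : `|expR x * cos y - 1 - x| <= (expR 1 + 2) * r ^+ 2.
  have -> : expR x * cos y - 1 - x
    = (expR x - 1 - x) * cos y + (1 + x) * (cos y - 1) by ring.
  rewrite [leRHS]mulrDl; apply: le_trans (ler_normD _ _) _; rewrite !normrM; apply: lerD.
    rewrite -[leRHS]mulr1 ler_pM//; last by rewrite ler_norml cos_geN1 cos_le1.
    by apply: le_trans (expRB1x_le x1) _; rewrite ler_wpM2l.
  rewrite ler_pM//; last by apply: le_trans (cosB1_le y1) _; rewrite mul1r.
  by apply: le_trans (ler_normD _ _) _; rewrite normr1; lra.
have hIm : `|expR x * sin y - y| <= (expR 1 + 1) * r ^+ 2.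
  have -> : expR x * sin y - y = (expR x - 1) * sin y + (sin y - y) by ring.
  rewrite [leRHS]mulrDl; apply: le_trans (ler_normD _ _) _; rewrite ?normrM; apply: lerD.
    rewrite expr2 mulrA ler_pM//.
      by apply: le_trans (expRB1_le x1) _; rewrite expr1 ler_wpM2l.
    by apply: le_trans (sin_le1 y1) _; rewrite expr1 mul1r.
  by apply: le_trans (sinBx_le y1) _; lra.
lra.
Qed.

(** The error must be cubic: after division by z it is still quadratic, which makes 2 sinh z / z
    differentiable at 0. The constant is 2e + 2 for each of the two coordinates. *)
Lemma dsinhB2z_le : exists2 c : R, 0 <= c &
  forall z, `|z| <= 1 -> `|dsinh z - 2 * z| <= c%:C * `|z| ^+ 3.
Proof.
have e0 : 0 <= expR 1 :> R := expR_ge0 _.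
exists (4 * expR 1 + 4) => [|[x y]]; first by lra.
have [r [-> xr yr r0]] := normC_bounds x y.
rewrite -(rmorph1 (real_complex R)) lecR => r1.
have x1 := le_trans xr r1; have y1 := le_trans yr r1.
have -> : dsinh (x +i* y) - 2 * (x +i* y) =
    ((expR x - expR (- x)) * cos y - 2 * x) +i*
    ((expR x + expR (- x)) * sin y - 2 * y).
  rewrite /dsinh [- (_ +i* _)]/(GRing.opp _)/= !cexpE cosN sinN; simpc.
  by congr (_ +i* _); ring.
apply: le_trans (normC_le _ _) _; rewrite -rmorphXn -rmorphM/= lecR.
have r2x : `|x| ^+ 2 <= r ^+ 2 by rewrite lerXn2r// nnegrE.
have r2y : `|y| ^+ 2 <= r ^+ 2 by rewrite lerXn2r// nnegrE.
have r3x : `|x| ^+ 3 <= r ^+ 3 by rewrite lerXn2r// nnegrE.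
have r3y : `|y| ^+ 3 <= r ^+ 3 by rewrite lerXn2r// nnegrE.
have hRe : `|(expR x - expR (- x)) * cos y - 2 * x| <= (2 * expR 1 + 2) * r ^+ 3.
  have -> : (expR x - expR (- x)) * cos y - 2 * x =
    (expR x - expR (- x) - 2 * x) * cos y + 2 * x * (cos y - 1) by ring.
  rewrite [leRHS]mulrDl; apply: le_trans (ler_normD _ _) _; rewrite !normrM; apply: lerD.
    rewrite -[leRHS]mulr1 ler_pM//; last by rewrite ler_norml cos_geN1 cos_le1.
    by apply: le_trans (expRBNx_le x1) _; rewrite ler_wpM2l// mulr_ge0.
  rewrite ger0_norm// -mulrA ler_wpM2l// exprS ler_pM//.
  by apply: le_trans (cosB1_le y1) _; rewrite mul1r.
have hIm : `|(expR x + expR (- x)) * sin y - 2 * y| <= (2 * expR 1 + 2) * r ^+ 3.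
  have -> : (expR x + expR (- x)) * sin y - 2 * y =
    (expR x + expR (- x) - 2) * sin y + 2 * (sin y - y) by ring.
  rewrite [leRHS]mulrDl; apply: le_trans (ler_normD _ _) _; rewrite !normrM; apply: lerD.
    rewrite exprSr mulrA ler_pM//.
      by apply: le_trans (expRDN_le x1) _; rewrite ler_wpM2l// mulr_ge0.
    by apply: le_trans (sin_le1 y1) _; rewrite expr1 mul1r.
  rewrite ger0_norm// ler_wpM2l//.
  by apply: le_trans (sinBx_le y1) _; rewrite mul1r.
lra.
Qed.

End ComplexExponential.

(** The quadratic error bounds the distance of the difference quotient from l by c |h|. *)
Lemma differentiable_quadratic_estimate (K : numFieldType) (f : K -> K) (z l c : K) :
  0 <= c -> (forall h, `|h| <= 1 -> `|f (z + h) - f z - l * h| <= c * `|h| ^+ 2) ->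
  differentiable (f : K^o -> K^o) z.
Proof.
move=> c0 hf; apply/derivable1_diffP/cvg_ex; exists l.
apply/cvgrPdist_le => e e0; near=> h.
have h0 : h != 0 by near: h; exact: nbhs_dnbhs_neq.
have h1 : `|h| <= 1 by near: h; exact: dnbhs0_le.
(* Dividing by c + 1 rather than c also covers c = 0. *)
have he : `|h| <= e / (c + 1).
  by near: h; apply: dnbhs0_le; rewrite divr_gt0// ltr_wpDl.
have -> : l - h^-1 *: ((f \o shift z) (h *: 1) - f z) =
    - (h^-1 * (f (z + h) - f z - l * h)).
  by rewrite /GRing.scale/= mulr1 [h + z]addrC; field.
rewrite normrN normrM normfV ler_pdivrMl ?normr_gt0// [leRHS]mulrC.
apply: le_trans (hf _ h1) _.
rewrite expr2 mulrA ler_wpM2r//; move: he; rewrite ler_pdivlMr ?ltr_wpDl//.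
by apply: le_trans; rewrite mulrC ler_wpM2l// lerDl.
Unshelve. all: by end_near. Qed.

(** * Holomorphy of the exponential and of 2 sinh z / z *)

Section ComplexDifferentiability.
Variable R : realType.
Local Notation C := R[i].
Local Open Scope complex_scope.

Lemma differentiable_cexp z : differentiable (@cexp R : C^o -> C^o) z.
Proof.
have [c c0 hc] := cexpB1z_le R.
apply: (@differentiable_quadratic_estimate _ _ z (cexp z) (`|cexp z| * c%:C)).
  by rewrite mulr_ge0// lecR.
move=> h h1; rewrite cexpD.
have -> : cexp z * cexp h - cexp z - cexp z * h = cexp z * (cexp h - 1 - h) by ring.
by rewrite normrM -mulrA ler_wpM2l// hc.
Qed.

Lemma diff_near_cexp (V : normedModType C) (x : V) (f : V -> C^o) :
  diff_near x f -> diff_near x (fun t => cexp (f t)).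
Proof.
apply: filterS => t ft.
exact: (@differentiable_comp _ _ _ _ f (@cexp R : C^o -> C^o) t ft (differentiable_cexp _)).
Qed.

Lemma diff_near_dsinh (V : normedModType C) (x : V) (f : V -> C^o) :
  diff_near x f -> diff_near x (fun t => dsinh (f t)).
Proof.
move=> hf; have hN : diff_near x (fun t => - f t : C^o).
  by apply: eq_diff_near (diff_nearM (diff_near_cst x (-1)) hf) => t; rewrite mulN1r.
apply: eq_diff_near (diff_nearD (diff_near_cexp hf)
  (diff_nearM (diff_near_cst x (-1)) (diff_near_cexp hN))) => t.
by rewrite mulN1r.
Qed.

(** The quotient 2 sinh z / z with its removable singularity filled in; it isolates the simple zero
    of [dsinh] at 0. *)
Definition dsinhc (z : C) : C := if z == 0 then 2 else dsinh z / z.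

Lemma dsinhcE z : dsinh z = z * dsinhc z.
Proof.
rewrite /dsinhc; case: eqVneq => [->|z0]; first by rewrite dsinh0 mul0r.
by rewrite mulrC divfK.
Qed.

Lemma differentiable_dsinhc0 : differentiable (dsinhc : C^o -> C^o) 0.
Proof.
have [c c0 hc] := dsinhB2z_le R.
(* The derivative at 0 is 0, as 2 sinh z / z is even. *)
apply: (@differentiable_quadratic_estimate _ _ 0 0 c%:C); first by rewrite lecR.
move=> h h1; rewrite add0r mul0r subr0 /dsinhc eqxx; case: eqVneq => [_|h0].
  by rewrite subrr normr0 mulr_ge0 ?lecR ?exprn_ge0.
have -> : dsinh h / h - 2 = (dsinh h - 2 * h) / h by field.
rewrite normrM normfV ler_pdivrMr ?normr_gt0// -mulrA -exprSr; exact: hc.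
Qed.

Lemma diff_near_dsinhc : diff_near (0 : C^o) dsinhc.
Proof.
apply: diff_nearW => z; have [->|z0] := eqVneq z 0; first exact: differentiable_dsinhc0.
have dq : diff_near (z : C^o) (fun t => dsinh t * t^-1 : C^o).
  have did : diff_near (z : C^o) (fun t => t : C^o).
    by apply: diff_nearW => t; apply/derivable1_diffP; exact: derivable_id.
  by apply: diff_nearM; [exact: diff_near_dsinh|exact: diff_nearV].
have /derivable1_diffP := nbhs_singleton dq.
move=> dz; apply/derivable1_diffP; apply: near_eq_derivable dz.
have : (\forall t \near z : C^o, t != 0)%classic.
  by apply: (@cvgr_neq0 _ C^o _ (nbhs (z : C^o)) _ id z).
by apply: filterS => t t0; rewrite /dsinhc (negbTE t0).
Qed.

End ComplexDifferentiability.

(** * The factor of a vertex *)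

Section VertexFactor.
Variables (R : realType) (k : nat).
Local Notation C := R[i].
Local Open Scope complex_scope.

(** A logarithm of zeta_{2k}^m. The arguments of all factors at a vertex are multiples of
    [half_turn m - t / 2]. *)
Definition half_turn (m : int) : C := (pi : R)%:C * 'i * (m%:~R / k%:R).

Lemma cexp_piMi (n : int) : cexp ((pi : R)%:C * 'i * n%:~R) = (-1) ^ n.
Proof.
have -> : (pi : R)%:C * 'i = 0 +i* pi by simpc.
rewrite mulrC cexpMz cexpE expR0 cospi sinpi mul1r mulr0.
have -> // : (-1 +i* 0 : C) = -1.
by apply/eqP; rewrite eq_complex/= oppr0 !eqxx.
Qed.

Lemma ee_int (n : int) : ee (n%:~R) = 1 :> C.
Proof.
have -> : ee (n%:~R) = cexp ((pi : R)%:C * 'i * (2 * n)%:~R) :> C.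
  by rewrite /ee intrM; congr cexp; ring.
by rewrite cexp_piMi -exprz_exp -exprnP sqrrN expr1n exp1rz.
Qed.

Lemma eeD (y z : C) : ee (y + z) = ee y * ee z.
Proof. by rewrite /ee mulrDr cexpD. Qed.

Hypothesis k_gt0 : (0 < k)%N.

Let kC0 : k%:R != 0 :> C.
Proof. by rewrite pnatr_eq0 -lt0n. Qed.

Lemma half_turnM (n : int) : half_turn (k%:Z * n) = (pi : R)%:C * 'i * n%:~R.
Proof. by rewrite /half_turn intrM -pmulrn; field. Qed.

Lemma half_turnN m : half_turn (- m) = - half_turn m.
Proof. by rewrite /half_turn mulrNz mulNr mulrN. Qed.

Lemma half_turnD m n : half_turn (m + n) = half_turn m + half_turn n.
Proof. by rewrite /half_turn intrD; ring. Qed.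

(** For k | m the exponential is a sign, hence its own inverse; this sign can be pulled out of the
    center factor. *)
Lemma cexpN_half_turn m : (k%:Z %| m)%Z -> cexp (- half_turn m) = cexp (half_turn m).
Proof.
case/dvdzP => n ->; rewrite mulrC half_turnM -mulrN -mulrNz !cexp_piMi.
by rewrite -exprz_inv invrN1.
Qed.

(** Write m = kn + r with 0 < r < k. Up to sign the value is 2i sin(pi r / k), and the sine is
    positive. So the center factor is regular at t = 0 when k does not divide m. *)
Lemma dsinh_half_turn_neq0 m : ~~ (k%:Z %| m)%Z -> dsinh (half_turn m) != 0.
Proof.
move=> km; have k0 : k%:Z != 0 by rewrite eqz_nat -lt0n.
have r0 : 0 < (m %% k%:Z)%Z.
  by rewrite lt_def modz_ge0// andbT; apply: contraNneq km => /dvdz_mod0P.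
have rk := ltz_pmod m (_ : 0 < k%:Z) => //.
have [n mE] : exists n, m = k%:Z * n + (m %% k%:Z)%Z.
  by exists (m %/ k%:Z)%Z; rewrite mulrC -divz_eq.
move: mE r0 (rk k_gt0); move: (m %% k%:Z)%Z => r -> r0 {}rk.
rewrite /dsinh half_turnD half_turnM opprD !cexpD -half_turnN.
have -> : - ((pi : R)%:C * 'i * n%:~R) = pi%:C * 'i * (- n)%:~R.
  by rewrite intrN mulrN.
rewrite !cexp_piMi -exprz_inv invrN1 -mulrBr.
rewrite mulf_neq0 ?expfz_neq0 ?oppr_eq0 ?oner_neq0// half_turnN.
have -> : half_turn r = 0 +i* (pi * (r%:~R / k%:R)).
  rewrite /half_turn -[in RHS](mul1r (pi * _)).
  have -> : r%:~R / k%:R = (r%:~R / k%:R : R)%:C.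
    by rewrite rmorphM/= fmorphV/= rmorph_int rmorph_nat.
  by simpc.
have -> : - (0 +i* (pi * (r%:~R / k%:R)) : C) = (0 +i* (- (pi * (r%:~R / k%:R)))).
  by apply/eqP; rewrite eq_complex/= oppr0 !eqxx.
rewrite !cexpE expR0 !mul1r cosN sinN subr_eq0 eq_complex/= eqxx/=.
rewrite -subr_eq0 opprK -mulr2n mulrn_eq0/= gt_eqF// sin_gt0_pi//.
have kR : 0 < k%:R :> R by rewrite ltr0n.
rewrite mulr_gt0 ?pi_gt0 ?divr_gt0 ?ltr0z//=.
by rewrite -[ltRHS]mulr1 ltr_pM2l ?pi_gt0// ltr_pdivrMr// mul1r pmulrn ltr_int.
Qed.

Variables (I : finType) (w : I -> int).

Definition leaf_factor (i : I) (m : int) (t : C) : C :=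
  dsinh ((half_turn m - t / 2) / (w i)%:~R).

(* The mean of [leaf_factor] at [m] and at any [m'] with
   [half_turn m' / w i = - half_turn m / w i] modulo [2 * pi * 'i]. *)
Definition even_leaf_factor (i : I) (m : int) (t : C) : C :=
  (cexp (half_turn m / (w i)%:~R) + cexp (- (half_turn m / (w i)%:~R))) / 2 *
  dsinh (- (t / 2) / (w i)%:~R).

Definition center_factor (d : nat) (m : int) (t : C) : C :=
  dsinh (half_turn m - t / 2) ^ (2 - d%:Z).

Definition vertex_factor (d : nat) (L : {set I}) (m : int) (t : C) : C :=
  center_factor d m t * \prod_(i in L) leaf_factor i m t.

Definition even_vertex_factor (d : nat) (L : {set I}) (m : int) (t : C) : C :=
  center_factor d m t *
  \prod_(i in L) (if (k%:Z %| m)%Z then even_leaf_factor i m t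
                   else leaf_factor i m t).

Let diff_near_affine (a b : C) : diff_near (0 : C^o) (fun t => a + t * b).
Proof.
apply: diff_nearD; first exact: diff_near_cst.
apply: diff_nearM; last exact: diff_near_cst.
by apply: diff_nearW => t; apply/derivable1_diffP; exact: derivable_id.
Qed.

Lemma diff_near_leaf_factor i m : diff_near (0 : C^o) (leaf_factor i m).
Proof.
apply: eq_diff_near (diff_near_dsinh
  (diff_near_affine (half_turn m / (w i)%:~R) (- (2^-1 / (w i)%:~R)))) => t.
by congr dsinh; ring.
Qed.

(** If k does not divide m, the factor is already holomorphic at 0 and e <= 0 only adds a power of
    t. If k | m, the center factor contributes t^(2 - d) and each averaged leaf factor a simple
    zero. The last clause gives the value at 0 when no pole is possible. *)
Lemma even_vertex_factor_order (d : nat) (L : {set I}) (m e : int) :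
  (2 <= d)%N -> (forall i, i \in L -> w i != 0) ->
  e <= Num.min 0 (2 - d%:Z + #|L|%:Z) ->
  exists phi : C -> C, [/\ diff_near (0 : C^o) phi,
    forall t, t != 0 -> even_vertex_factor d L m t = t ^ e * phi t &
    e = 0 -> d = 2%N \/ (0 < 2 - d%:Z + #|L|%:Z) ->
    phi 0 = if (k%:Z %| m)%Z && (L != finset.set0) then 0 else vertex_factor d L m 0].
Proof.
move=> d2 w0; rewrite le_min => /andP[e0 eL].
have [km|km] := boolP (k%:Z %| m)%Z; last first.
  have mC : even_vertex_factor d L m =1 vertex_factor d L m.
    by move=> t; congr (_ * _); apply: eq_bigr => i _; rewrite (negbTE km).
  have [n eE] : exists n : nat, e = - n%:Z by exists `|e|%N; lia.
  exists (fun t => t ^+ n * vertex_factor d L m t); split=> [|t t0|].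
  - apply: diff_nearM.
      apply: diff_nearX; apply: diff_nearW => t.
      by apply/derivable1_diffP; exact: derivable_id.
    apply: diff_nearM; last by apply: diff_near_prod => i _; exact: diff_near_leaf_factor.
    apply: diff_nearXz; last by rewrite mul0r subr0 dsinh_half_turn_neq0.
    apply: eq_diff_near (diff_near_dsinh (diff_near_affine (half_turn m) (- 2^-1))) => t.
    by congr dsinh; ring.
  - by rewrite mC mulrA eE -exprnN mulVf ?mul1r// expf_neq0.
  - by rewrite eE => /eqP; rewrite oppr_eq0 => /eqP[->] _; rewrite expr0 mul1r.
pose c i : C := (cexp (half_turn m / (w i)%:~R) + cexp (- (half_turn m / (w i)%:~R))) / 2.
pose a i : C := - (2^-1 / (w i)%:~R).
(* What remains of the factor once one power of t is taken out of each [dsinh]. *)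
pose ph (t : C) : C := (cexp (half_turn m) * - 2^-1 * dsinhc (t * - 2^-1)) ^ (2 - d%:Z) *
  \prod_(i in L) (c i * a i * dsinhc (t * a i)).
have dsc (b : C) : diff_near (0 : C^o) (fun t => dsinhc (t * b)).
  apply: (@diff_near_comp _ _ _ (0 : C^o) (fun t => t * b : C^o) (@dsinhc R)).
    move=> t; apply/derivable1_diffP.
    apply: derivableM; [exact: derivable_id|exact: derivable_cst].
  by rewrite mul0r; exact: diff_near_dsinhc.
have dph : diff_near (0 : C^o) ph.
  apply: diff_nearM.
    apply: diff_nearXz; first by apply: diff_nearM; [exact: diff_near_cst|].
    rewrite mul0r /dsinhc eqxx mulf_neq0 ?pnatr_eq0//.
    by rewrite mulf_neq0 ?cexp_neq0// oppr_eq0 invr_eq0 pnatr_eq0.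
  apply: diff_near_prod => i _.
  by apply: diff_nearM; [exact: diff_near_cst|].
have [n eE] : exists n : nat, 2 - d%:Z + #|L|%:Z = e + n%:Z.
  by exists `|(2 - d%:Z + #|L|%:Z - e)%R|%N; lia.
have evE t : t != 0 ->
    even_vertex_factor d L m t = t ^ (2 - d%:Z + #|L|%:Z) * ph t.
  move=> t0; rewrite expfzDr// /ph /even_vertex_factor km.
  rewrite mulrACA; congr (_ * _).
    rewrite -expfzMl /center_factor; congr (_ ^ _).
    rewrite dsinhD cexpN_half_turn// -mulrBr -/(dsinh _) -[t / 2]mulr1.
    have -> : - (t / 2 * 1) = t * - 2^-1 by ring.
    by rewrite dsinhcE; ring.
  rewrite -exprnP -prodr_const -big_split/=; apply: eq_bigr => i iL.
  rewrite /even_leaf_factor -/(c i).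
  have -> : - (t / 2) / (w i)%:~R = t * a i by rewrite /a; ring.
  by rewrite dsinhcE; ring.
exists (fun t => t ^+ n * ph t); split=> [|t t0|e00 hd].
- apply: diff_nearM => //.
  apply: diff_nearX; apply: diff_nearW => t.
  by apply/derivable1_diffP; exact: derivable_id.
- by rewrite evE// eE expfzDr// -exprnP -mulrA.
(* If L is nonempty, the exponent n is positive and the value is 0. If L is empty, then d = 2, n = 0
   and both sides are 1. *)
- have [L0|L0] := eqVneq L finset.set0; last first.
    move: eE; rewrite e00 add0r; move: hd; rewrite -card_gt0 in L0.
    case: n => [hd|n _ _]; last by rewrite expr0n mul0r.
    by case: hd => [->|]; lia.
  move: hd; rewrite L0 cards0 => hd.
  have dE : d = 2%N by move: eE; case: hd => [->//|]; rewrite L0 cards0; lia.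
  have n0 : n = 0%N by move: eE; rewrite L0 cards0; lia.
  by rewrite n0 expr0 mul1r ?eqxx /= /ph /vertex_factor /center_factor dE subrr !expr0z L0 !big_set0.
Qed.

End VertexFactor.

(** * The linking matrix and its inverse *)

Section LinkingMatrix.
Variables (V : finType) (G : plumbing V).
Hypothesis hdet : \det (linking G) = 1 \/ \det (linking G) = -1.
Hypothesis hleaf : forall i, i \in leaves G -> weight G i <= -2.

Definition link (u v : V) : int :=
  if u == v then weight G u else (adj G u v)%:R.

Definition winv (u v : V) : int :=
  invmx (linking G) (enum_rank u) (enum_rank v).

Let linking_link u v : linking G (enum_rank u) (enum_rank v) = link u v.
Proof. by rewrite mxE /link !enum_rankK (inj_eq enum_rank_inj). Qed.

Let linking_unit : linking G \in unitmx.
Proof. by rewrite unitmxE; case: hdet => ->. Qed.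

Lemma link_winv u v : \sum_w link u w * winv w v = (u == v)%:R.
Proof.
have := congr1 (fun A : 'M[int]_#|V| => A (enum_rank u) (enum_rank v)) (mulmxV linking_unit).
rewrite !mxE (inj_eq enum_rank_inj) => <-.
rewrite (reindex (@enum_rank V)); last by apply: onW_bij; exact: enum_rank_bij.
by apply: eq_bigr => w _; rewrite linking_link.
Qed.

Lemma winv_link u v : \sum_w winv u w * link w v = (u == v)%:R.
Proof.
have := congr1 (fun A : 'M[int]_#|V| => A (enum_rank u) (enum_rank v)) (mulVmx linking_unit).
rewrite !mxE (inj_eq enum_rank_inj) => <-.
rewrite (reindex (@enum_rank V)); last by apply: onW_bij; exact: enum_rank_bij.
by apply: eq_bigr => w _; rewrite linking_link.
Qed.

Lemma link_sym u v : link u v = link v u.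
Proof. by rewrite /link eq_sym adj_sym; case: eqP => // ->. Qed.

Lemma leaf_nbrsP v i :
  reflect (i \in leaves G /\ adj G i v) (i \in leaf_nbrs G v).
Proof. by rewrite /leaf_nbrs !inE; apply: andP. Qed.

Lemma leaf_adj i v u : i \in leaf_nbrs G v -> adj G i u = (u == v).
Proof.
case/leaf_nbrsP; rewrite inE /deg => /cards1P[x xE] iv.
have := erefl (u \in [set x]); rewrite -{1}xE inE => ->.
by have := erefl (v \in [set x]); rewrite -{1}xE inE iv inE => /esym/eqP ->; rewrite inE.
Qed.

Lemma leaf_neq i v : i \in leaf_nbrs G v -> i != v.
Proof. by case/leaf_nbrsP => _; apply: contraTneq => ->; rewrite adj_irrefl. Qed.

(** The row of a leaf in W has only two nonzero entries. Applied to W^-1 this yields the coprimality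
    of leaf weights, the divisibility of S(Z^V2) and the elimination of the leaves. *)
Lemma leaf_row i v (z : V -> int) : i \in leaf_nbrs G v ->
  \sum_u link i u * z u = weight G i * z i + z v.
Proof.
move=> iv; have niv := leaf_neq iv.
rewrite (bigD1 i)//= /link eqxx; congr (_ + _).
rewrite (bigD1 v); last by rewrite eq_sym.
rewrite /= big1 => [|u /andP[ui uv]].
  by rewrite (negbTE niv) (leaf_adj _ iv) eqxx mul1r addr0.
by rewrite eq_sym (negbTE ui) (leaf_adj _ iv) (negbTE uv) mul0r.
Qed.

Lemma leaf_nbrs_disjoint i u v :
  i \in leaf_nbrs G u -> i \in leaf_nbrs G v -> u = v.
Proof. by move=> iu /leaf_nbrsP[_]; rewrite (leaf_adj _ iu) => /eqP. Qed.

Lemma leaf_weight_neq0 v i : i \in leaf_nbrs G v -> weight G i != 0.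
Proof. by case/leaf_nbrsP => /hleaf wi _; apply: contraTneq wi => ->. Qed.

Lemma Mint_neq0 v : Mint G v != 0.
Proof. by apply/prodf_neq0 => i; exact: leaf_weight_neq0. Qed.

Lemma leaf_coprime v i j : i \in leaf_nbrs G v -> j \in leaf_nbrs G v ->
  i != j -> coprimez (weight G i) (weight G j).
Proof.
move=> iv jv ij; apply/coprimezP.
(* Rows i and j of W W^-1 = 1, both read in column i, form a Bezout relation. *)
exists (winv i i, - winv j i) => /=.
have := link_winv i i; rewrite (leaf_row (fun u => winv u i) iv) eqxx.
have := link_winv j i; rewrite (leaf_row (fun u => winv u i) jv) eq_sym (negbTE ij).
by rewrite mulr0n mulr1n; lia.
Qed.

Lemma coprimez_prod (I : Type) (r : seq I) (P : pred I) (w : I -> int) (x : int) :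
  (forall i, P i -> coprimez x (w i)) -> coprimez x (\prod_(i <- r | P i) w i).
Proof.
move=> wx; elim/big_rec: _ => [|i y Pi xy]; first by rewrite /coprimez gcdz1.
by rewrite coprimezMr xy andbT wx.
Qed.

Lemma prod_dvdz (I : finType) (A : {set I}) (w : I -> int) (x : int) :
  {in A &, forall i j, i != j -> coprimez (w i) (w j)} ->
  (forall i, i \in A -> (w i %| x)%Z) -> (\prod_(i in A) w i %| x)%Z.
Proof.
move=> wcop wx; rewrite -big_enum.
have : {subset enum A <= A} by move=> i; rewrite mem_enum.
elim: (enum A) (enum_uniq A) => [_ _|i s IHs /=/andP[is_ us] sA].
  by rewrite big_nil dvd1z.
have iA : i \in A by rewrite sA ?mem_head.
have sA' : {subset s <= A} by move=> j js; rewrite sA ?inE ?js ?orbT.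
rewrite big_cons Gauss_dvdz ?wx ?IHs//.
rewrite big_seq; apply: coprimez_prod => j js.
by apply: (wcop _ _ iA (sA' _ js)); apply: contraTneq js => <-.
Qed.

Lemma SmxE a b : Smx G a b = - winv (vtx a) (vtx b).
Proof. by rewrite !mxE. Qed.

(** Extend Sx to z = -W^-1 x on all vertices, with x zero on the leaves. Row i of Wz = -x at a leaf
    i next to v reads w_i z_i + z_v = 0, so w_i | z_v. Coprimality of the w_i then gives M_v |
    z_v. *)
Lemma Smx_image_dvd (x : 'cV[int]_#|V2 G|) a :
  (Mint G (vtx a) %| (Smx G *m x) a 0%R)%Z.
Proof.
apply: prod_dvdz => [i j iv jv|i iv]; first exact: leaf_coprime iv jv.
pose z u := - \sum_b winv u (vtx b) * x b 0.
have -> : (Smx G *m x) a 0 = z (vtx a).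
  rewrite mxE /z -sumrN; apply: eq_bigr => b _; by rewrite SmxE mulNr.
have : \sum_u link i u * z u = 0.
  transitivity (- \sum_b (\sum_u link i u * winv u (vtx b)) * x b 0).
    under [in RHS]eq_bigr do rewrite mulr_suml.
    rewrite exchange_big/= -sumrN; apply: eq_bigr => u _.
    by rewrite mulrN mulr_sumr; congr (- _); apply: eq_bigr => b _; rewrite mulrA.
  rewrite big1 ?oppr0// => b _; rewrite link_winv.
  have := enum_valP b; rewrite -/(vtx b) inE => b2.
  case: eqP => [ib|]; last by rewrite mul0r.
  by case/leaf_nbrsP: iv; rewrite inE ib => /eqP b1; rewrite b1 in b2.
rewrite (leaf_row _ iv) => zi.
by apply/dvdzP; exists (- z i); rewrite mulNr mulrC; lia.
Qed.

(** * The inverse of S in closed form *)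

Section Inverse.
Variable F : numFieldType.

(** The Schur complement of the leaf block in -W, which is the inverse of S. *)
Definition Tmx : 'M[F]_#|V2 G| := \matrix_(a, b)
  if a == b then - (weight G (vtx a))%:~R +
                 \sum_(i in leaf_nbrs G (vtx a)) (weight G i)%:~R^-1
  else - (adj G (vtx a) (vtx b))%:R.

Lemma Tmx_sym a b : Tmx a b = Tmx b a.
Proof. by rewrite !mxE eq_sym adj_sym; case: eqP => [->|]. Qed.

Lemma vtx_V2 (a : 'I_#|V2 G|) : vtx a \in V2 G.
Proof. exact: enum_valP. Qed.

Lemma non_V2_leaf u v : adj G u v -> (u \notin V2 G) = (u \in leaf_nbrs G v).
Proof.
move=> uv; rewrite !inE uv andbT -leqNgt.
have : (0 < deg G u)%N by apply/card_gt0P; exists v; rewrite inE.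
by case: (deg G u) => [|[|]].
Qed.

Lemma sum_V2 (M : nmodType) (f : V -> M) :
  \sum_(a < #|V2 G|) f (vtx a) = \sum_(u in V2 G) f u.
Proof. by rewrite [RHS]big_enum_val. Qed.

(** In row a of W^-1 W = 1, the column of a leaf i at b gives W^-1(a, i) = - W^-1(a, b) / w_i,
    because a is not a leaf. Substituting this in column b eliminates the leaves and leaves row a of
    S times column b of T. *)
Lemma Smx_Tmx : map_mx intr (Smx G) *m Tmx = 1%:M.
Proof.
apply/matrixP => a b; rewrite !mxE.
have wl i : i \in leaf_nbrs G (vtx b) ->
    (winv (vtx a) i)%:~R = - ((winv (vtx a) (vtx b))%:~R / (weight G i)%:~R) :> F.
  move=> ib; have w0 : (weight G i)%:~R != 0 :> F.
    by rewrite intr_eq0 (leaf_weight_neq0 ib).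
  apply: (mulIf w0); rewrite mulNr divfK//.
  apply/eqP; rewrite -subr_eq0 opprK -intrM -intrD intr_eq0; apply/eqP.
  have := winv_link (vtx a) i.
  under eq_bigr do rewrite link_sym mulrC.
  rewrite (leaf_row _ ib) mulrC => ->; case: eqP => // ai.
  case/leaf_nbrsP: ib; have := vtx_V2 a; rewrite ai inE => i2.
  by rewrite inE => /eqP i1; rewrite i1 in i2.
have := congr1 (intr : int -> F) (winv_link (vtx a) (vtx b)).
rewrite (inj_eq enum_val_inj) rmorph_nat => <-.
rewrite rmorph_sum/= (bigID (fun u => u \in V2 G))/=.
rewrite [X in _ = _ + X](bigID (fun u => adj G u (vtx b)))/=.
rewrite [X in _ = _ + (_ + X)]big1 ?addr0; last first.
  move=> u /andP[u2 /negbTE ub]; rewrite /link ub.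
  case: eqP => [uE|]; first by rewrite uE vtx_V2 in u2.
  by rewrite mulr0.
have -> : \sum_(u | (u \notin V2 G) && adj G u (vtx b))
      ((winv (vtx a) u * link u (vtx b))%:~R : F) =
    \sum_(i in leaf_nbrs G (vtx b))
      - ((winv (vtx a) (vtx b))%:~R / (weight G i)%:~R).
  apply: eq_big => [u|u /andP[u2 ub]].
    have [ub|ub] := boolP (adj G u (vtx b)); first by rewrite andbT (non_V2_leaf ub).
    by rewrite andbF; apply/esym/negbTE/negP => /leaf_nbrsP[_]; apply/negP.
  have ul : u \in leaf_nbrs G (vtx b) by rewrite -(non_V2_leaf ub).
  by rewrite -wl// /link (negbTE (leaf_neq ul)) ub mulr1.
rewrite -[X in _ = X + _]sum_V2 (bigD1 b)//= [in RHS](bigD1 b)//=.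
rewrite addrAC; congr (_ + _).
  rewrite !mxE eqxx /link eqxx sumrN -mulr_sumr intrM rmorphN/=; ring.
apply: eq_bigr => c cb; rewrite !mxE (negbTE cb) /link (inj_eq enum_val_inj) (negbTE cb).
by rewrite intrM rmorphN/= mulrNN rmorph_nat.
Qed.

Lemma invmx_Smx : invmx (map_mx intr (Smx G)) = Tmx.
Proof.
have [U _] := mulmx1_unit Smx_Tmx.
by rewrite -[RHS](mulKmx U) Smx_Tmx mulmx1.
Qed.

End Inverse.

(** The preimage is x = T y. It is integral because each w_i divides M_v and hence y_v, so the
    integer divisions in x are exact. *)
Lemma dvd_Smx_image (y : 'cV[int]_#|V2 G|) :
  (forall a, (Mint G (vtx a) %| y a 0%R)%Z) -> exists x, y = Smx G *m x.
Proof.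
move=> My.
pose x : 'cV[int]_#|V2 G| := \col_a (\sum_b (if a == b then - weight G (vtx a) * y a 0 +
    \sum_(i in leaf_nbrs G (vtx a)) (y a 0%R %/ weight G i)%Z
  else - (adj G (vtx a) (vtx b))%:R * y b 0)).
exists x.
(* The comparison is made over the rationals, where S T = 1 is available. *)
suff E : map_mx intr y = map_mx intr (Smx G *m x) :> 'cV[rat]_#|V2 G|.
  apply/matrixP => a o; have := congr1 (fun A : 'cV[rat]_#|V2 G| => A a o) E.
  by rewrite mxE [in RHS]mxE => /intr_inj.
rewrite map_mxM -[LHS]mul1mx -(Smx_Tmx rat) -mulmxA; congr (_ *m _).
apply/colP => a; rewrite !mxE rmorph_sum; apply: eq_bigr => b _.
rewrite !mxE; case: eqVneq => [<-|_]; last first.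
  by rewrite rmorphM rmorphN/= rmorph_nat.
rewrite mulrDl rmorphD rmorphM rmorphN rmorph_sum/=; congr (_ + _).
rewrite mulr_suml; apply: eq_bigr => i ia.
have w0 : (weight G i)%:~R != 0 :> rat by rewrite intr_eq0 (leaf_weight_neq0 ia).
apply: (mulIf w0); rewrite mulrAC mulVf// mul1r -intrM divzK//.
apply: dvdz_trans (My a); rewrite /Mint (bigD1 i)//=; exact: dvdz_mulr.
Qed.

End LinkingMatrix.

(** * The Gauss phase *)

Section Phase.
Variables (R : realType) (V : finType) (G : plumbing V) (k : nat).
Hypothesis hdet : \det (linking G) = 1 \/ \det (linking G) = -1.
Hypothesis hleaf : forall i, i \in leaves G -> weight G i <= -2.
Hypothesis k_gt0 : (0 < k)%N.
Local Notation C := R[i].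
Local Notation T := (Tmx G C).
Local Notation vec := 'cV[int]_#|V2 G|.
Implicit Types mu nu : vec.

Let kC0 : k%:R != 0 :> C.
Proof. by rewrite pnatr_eq0 -lt0n. Qed.

Definition qform mu : C := \sum_a \sum_b (mu a 0)%:~R * T a b * (mu b 0)%:~R.

Lemma gauss_phaseE mu : gauss_phase k R mu = ee (- (4 * k)%:R^-1 * qform mu).
Proof.
rewrite /gauss_phase invmx_Smx//; congr (ee (_ * _)).
rewrite mxE /qform exchange_big/=; apply: eq_bigr => b _.
rewrite !mxE mulr_suml; apply: eq_bigr => a _; by rewrite !mxE.
Qed.

(** The increment is nu^T T (2 mu + nu), by symmetry of T. All invariances of the phase are read off
    from it. *)
Lemma qformD mu nu : qform (mu + nu) = qform mu +
  \sum_a (nu a 0)%:~R * \sum_b T a b * (2 * mu b 0 + nu b 0)%:~R.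
Proof.
have -> : \sum_a (nu a 0)%:~R * \sum_b T a b * (2 * mu b 0 + nu b 0)%:~R =
    \sum_a \sum_b (nu a 0)%:~R * T a b * (mu b 0 + nu b 0)%:~R +
    \sum_a \sum_b (mu a 0)%:~R * T a b * (nu b 0)%:~R.
  rewrite [X in _ = _ + X]exchange_big -big_split/=; apply: eq_bigr => a _.
  rewrite -big_split mulr_sumr/=; apply: eq_bigr => b _.
  by rewrite !(intrD, intrM) (Tmx_sym C b a); ring.
rewrite addrCA /qform -!big_split/=; apply: eq_bigr => a _.
rewrite -!big_split/=; apply: eq_bigr => b _.
by rewrite !mxE !intrD; ring.
Qed.

Lemma gauss_phase_shift mu nu (n : int) :
  \sum_a (nu a 0)%:~R * \sum_b T a b * (2 * mu b 0 + nu b 0)%:~R = (4 * k)%:R * n%:~R ->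
  gauss_phase k R (mu + nu) = gauss_phase k R mu.
Proof.
move=> E; rewrite !gauss_phaseE qformD E mulrDr eeD.
have -> : - (4 * k)%:R^-1 * ((4 * k)%:R * n%:~R) = (- n)%:~R :> C.
  by rewrite natrM intrN; field.
by rewrite ee_int mulr1.
Qed.

Lemma gauss_phase_periodic mu nu :
  (forall a, ((2 * k)%:Z * Mint G (vtx a) %| nu a 0%R)%Z) ->
  gauss_phase k R (mu + nu) = gauss_phase k R mu.
Proof.
move=> hnu.
have k20 : (2 * k)%:Z != 0 by rewrite eqz_nat muln_eq0/= -lt0n.
have [x xE] : exists x, (\col_a (nu a 0%R %/ (2 * k)%:Z)%Z) = Smx G *m x.
  apply: dvd_Smx_image => // a; rewrite mxE.
  have /dvdzP[q ->] := hnu a.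
  by rewrite mulrCA mulKz// dvdz_mull.
have nuE : nu = (2 * k)%:Z *: (Smx G *m x).
  rewrite -xE; apply/colP => a; rewrite !mxE mulrC divzK//.
  exact: dvdz_trans (dvdz_mulr _ (dvdzz _)) (hnu a).
(* With nu = 2k S x one has T nu = 2k x, so the increment is 4k (mu . x) + 4k^2 (Sx . x). *)
apply: (@gauss_phase_shift _ _ (\sum_b mu b 0 * x b 0 + k%:Z * \sum_b (Smx G *m x) b 0 * x b 0)).
have Tnu a : \sum_b T a b * (nu b 0)%:~R = (2 * k)%:R * (x a 0)%:~R.
  have : T *m map_mx intr nu = (2 * k)%:R *: map_mx intr x.
    rewrite nuE map_mxZ map_mxM/= -scalemxAr mulmxA.
    by rewrite (mulmx1C (Smx_Tmx hdet hleaf C)) mul1mx -?pmulrn.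
  move=> /(congr1 (fun A : 'cV[C]_#|V2 G| => A a 0)).
  rewrite [LHS]mxE [RHS]mxE [in RHS]mxE => <-.
  by apply: eq_bigr => b _; congr (_ * _); rewrite mxE.
transitivity (\sum_a (2 * mu a 0)%:~R * (\sum_b T a b * (nu b 0)%:~R) +
              \sum_a (nu a 0)%:~R * (\sum_b T a b * (nu b 0)%:~R)).
  have -> : \sum_a (2 * mu a 0)%:~R * (\sum_b T a b * (nu b 0)%:~R) =
      \sum_a (nu a 0)%:~R * (\sum_b T a b * (2 * mu b 0)%:~R).
    transitivity (\sum_a \sum_b (2 * mu a 0)%:~R * (T a b * (nu b 0)%:~R)).
      by apply: eq_bigr => a _; rewrite mulr_sumr.
    rewrite exchange_big; apply: eq_bigr => a _; rewrite mulr_sumr.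
    by apply: eq_bigr => b _; rewrite (Tmx_sym C b a); ring.
  rewrite -big_split; apply: eq_bigr => a _ /=.
  rewrite -mulrDr -big_split; congr (_ * _); apply: eq_bigr => b _ /=.
  by rewrite intrD mulrDr.
rewrite !(rmorphD, rmorphM, rmorph_sum)/= mulrDr !mulr_sumr; congr (_ + _).
  by apply: eq_bigr => a _; rewrite Tnu !natrM !intrM; ring.
apply: eq_bigr => a _; rewrite Tnu {1}nuE mxE !natrM !intrM -!pmulrn !natrM; ring.
Qed.

(** Only coordinate a moves. The diagonal part of the increment carries u^2 - 1, whose factor 4 M_v
    also clears the denominators 1 / w_i of T(a, a). The off-diagonal part is integral and carries 2
    (u - 1). *)
Lemma gauss_phase_scale mu (a : 'I_#|V2 G|) (u : int) :
  (k%:Z %| mu a 0%R)%Z -> (2 %| u - 1)%Z -> (4 * Mint G (vtx a) %| u ^+ 2 - 1)%Z ->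
  gauss_phase k R (\col_b (if b == a then u * mu b 0 else mu b 0)) =
  gauss_phase k R mu.
Proof.
move=> /dvdzP[n muE] /dvdzP[h uE] /dvdzP[g u2E].
pose nu : vec := \col_b (if b == a then (u - 1) * mu b 0 else 0).
have -> : \col_b (if b == a then u * mu b 0 else mu b 0) = mu + nu.
  by apply/colP => b; rewrite !mxE; case: eqP => _; ring.
have [N TN] : exists N : int, T a a * (Mint G (vtx a))%:~R = N%:~R.
  exists (- weight G (vtx a) * Mint G (vtx a) +
    \sum_(i in leaf_nbrs G (vtx a)) (Mint G (vtx a) %/ weight G i)%Z).
  rewrite mxE eqxx mulrDl mulr_suml rmorphD rmorphM rmorphN rmorph_sum/=.
  congr (_ + _); apply: eq_bigr => i ia.
  have w0 : (weight G i)%:~R != 0 :> C.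
    by rewrite intr_eq0 (leaf_weight_neq0 hleaf ia).
  apply: (mulIf w0); rewrite mulrAC mulVf// mul1r -intrM divzK//.
  by rewrite /Mint (bigD1 i)//=; exact: dvdz_mulr.
have [N' TN'] : exists N' : int, \sum_(b | b != a) T a b * (mu b 0)%:~R = N'%:~R.
  exists (\sum_(b | b != a) - (adj G (vtx a) (vtx b))%:R * mu b 0).
  rewrite rmorph_sum; apply: eq_bigr => b /negbTE ba.
  by rewrite mxE eq_sym ba rmorphM rmorphN/= rmorph_nat.
(* Here mu_a = nk, u - 1 = 2h and u^2 - 1 = 4 g M_v; the two summands are the diagonal and
   off-diagonal parts divided by 4k. *)
apply: (@gauss_phase_shift _ _ (k%:Z * n ^+ 2 * g * N + n * h * N')).
rewrite (bigD1 a)//= [X in _ + X]big1 ?addr0 => [|b /negbTE ba]; last first.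
  by rewrite mxE ba mul0r.
rewrite (bigD1 a)//=.
rewrite (eq_bigr (fun b => 2 * (T a b * (mu b 0)%:~R))) => [|b /negbTE ba]; last first.
  by rewrite [nu b 0]mxE ba addr0 intrM; ring.
rewrite -mulr_sumr TN' mxE eqxx muE.
have -> : 2 * (n * k%:Z) + (u - 1) * (n * k%:Z) = (u + 1) * (n * k%:Z) by ring.
have uu : (u + 1)%:~R * (u - 1)%:~R = g%:~R * (4 * (Mint G (vtx a))%:~R) :> C.
  rewrite -intrM (_ : (u + 1) * (u - 1) = u ^+ 2 - 1); last by ring.
  by rewrite u2E; ring.
transitivity (n%:~R ^+ 2 * k%:R ^+ 2 * T a a * ((u + 1)%:~R * (u - 1)%:~R) +
   2 * N'%:~R * n%:~R * k%:R * (u - 1)%:~R : C).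
  by rewrite !intrM -!pmulrn; ring.
rewrite uu (_ : _ * (_ * (4 * _)) =
  n%:~R ^+ 2 * k%:R ^+ 2 * g%:~R * 4 * (T a a * (Mint G (vtx a))%:~R)); last by ring.
by rewrite TN uE !(intrD, intrM, natrM, rmorphXn)/= -!pmulrn; ring.
Qed.

(** Negating mu on A changes only the cross terms between A and its complement. The single edge c -
    d contributes 4 mu_c mu_d, a multiple of 4k since k | mu_d. *)
Lemma gauss_phase_reflect mu (A : pred 'I_#|V2 G|) (c d : 'I_#|V2 G|) :
  A c -> ~~ A d -> adj G (vtx c) (vtx d) ->
  (forall a b, A a -> ~~ A b -> adj G (vtx a) (vtx b) -> a = c /\ b = d) ->
  (k%:Z %| mu d 0%R)%Z ->
  gauss_phase k R (\col_b (if A b then - mu b 0 else mu b 0)) = gauss_phase k R mu.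
Proof.
move=> Ac Ad cd Acd /dvdzP[n muE].
pose nu : vec := \col_b (if A b then - 2 * mu b 0 else 0).
have -> : \col_b (if A b then - mu b 0 else mu b 0) = mu + nu.
  by apply/colP => b; rewrite !mxE; case: ifP => _; ring.
apply: (@gauss_phase_shift _ _ (mu c 0 * n)).
have cd0 : c != d by apply: contraNneq Ad => <-.
rewrite (bigID A)/= [X in _ + X]big1 ?addr0 => [|b /negbTE bA]; last first.
  by rewrite mxE bA mul0r.
rewrite (bigD1 c)//= [X in _ + X]big1 ?addr0 => [|a /andP[Aa ac]].
  rewrite (bigD1 d)//= [X in _ + X]big1 ?addr0 => [|b bd]; last first.
    rewrite [nu b 0]mxE; case: ifPn => bA; first by rewrite mulNr addrN mulr0.
    rewrite addr0 mxE; case: eqVneq => [cb|cb]; first by rewrite -cb Ac in bA.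
    case: (boolP (adj _ _ _)) => [adjcb|_]; last by rewrite oppr0 mul0r.
    by have [_ bE] := Acd _ _ Ac bA adjcb; rewrite bE eqxx in bd.
  rewrite !mxE (negbTE cd0) cd Ac (negbTE Ad) addr0 muE.
  by rewrite !(intrM, natrM) rmorphN/= -!pmulrn; ring.
rewrite [X in _ * X]big1 ?mulr0// => b _.
rewrite [nu b 0]mxE; case: ifPn => bA; first by rewrite mulNr addrN mulr0.
rewrite addr0 mxE; case: eqVneq => [ab|_]; first by rewrite -ab Aa in bA.
case: (boolP (adj _ _ _)) => [adjab|_]; last by rewrite oppr0 mul0r.
by have [aE _] := Acd _ _ Aa bA adjab; rewrite aE eqxx in ac.
Qed.

End Phase.

(** * Sums over classes *)

Section Classes.
Variables (R : realType) (V : finType) (G : plumbing V) (k : nat).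
Hypothesis hdet : \det (linking G) = 1 \/ \det (linking G) = -1.
Hypothesis hleaf : forall i, i \in leaves G -> weight G i <= -2.
Hypothesis k_gt0 : (0 < k)%N.
Local Notation C := R[i].
Local Notation vec := 'cV[int]_#|V2 G|.
Implicit Types mu nu : vec.

Definition period (a : 'I_#|V2 G|) : int := (2 * k)%:Z * Mint G (vtx a).

Definition congr_vec mu nu := forall a, (period a %| mu a 0%R - nu a 0%R)%Z.

Lemma period_neq0 a : period a != 0.
Proof.
by rewrite mulf_neq0 ?(Mint_neq0 hleaf)// eqz_nat muln_eq0/= -lt0n.
Qed.

Lemma congr_vec_refl mu : congr_vec mu mu.
Proof. by move=> a; rewrite subrr dvdz0. Qed.

Lemma congr_vec_sym mu nu : congr_vec mu nu -> congr_vec nu mu.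
Proof. by move=> h a; rewrite -opprB rpredN. Qed.

Lemma congr_vec_trans mu nu rho :
  congr_vec mu nu -> congr_vec nu rho -> congr_vec mu rho.
Proof.
by move=> h1 h2 a; rewrite -(subrK (nu a 0) (mu a 0)) -addrA rpredD.
Qed.

(** The two divisibility lemmas identify 2k S(Z^V2) with the product of the ideals generated by the
    2k M_v, so classes can be tested coordinatewise. *)
Lemma class_ofP mu nu : class_of k mu nu <-> congr_vec mu nu.
Proof.
have k20 : (2 * k)%:Z != 0 by rewrite eqz_nat muln_eq0/= -lt0n.
split=> [[x _ <-] a|h].
  rewrite mxE opprD addNKr rpredN mxE dvdz_mul//.
  exact: Smx_image_dvd.
have [a|x xE] := @dvd_Smx_image _ _ hdet hleaf
    (\col_a ((nu a 0%R - mu a 0%R) %/ (2 * k)%:Z)%Z).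
  have /dvdzP[q E] := congr_vec_sym h a.
  by rewrite mxE E mulrCA mulKz// dvdz_mull.
exists x => //; rewrite -xE; apply/colP => a; rewrite !mxE [_ * _]mulrC divzK ?addrNK//.
  by rewrite addrC subrK.
exact: dvdz_trans (dvdz_mulr _ (dvdzz _)) (congr_vec_sym h a).
Qed.

Lemma class_of_congr mu nu : congr_vec mu nu -> class_of k mu = class_of k nu.
Proof.
move=> h; apply/seteqP; split=> x /class_ofP hx; apply/class_ofP.
  exact: congr_vec_trans (congr_vec_sym h) hx.
exact: congr_vec_trans h hx.
Qed.

(** A finite set of representatives of the classes; the function type is dependent because each
    coordinate has its own period. *)
Definition box := {dffun forall a : 'I_#|V2 G|, 'I_(`|period a|%N)}.

Definition box_vec (x : box) : vec := \col_a (x a : nat)%:Z.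

Lemma box_index_subproof mu a : (`|(mu a 0%R %% period a)%Z| < `|period a|)%N.
Proof.
rewrite -ltz_nat gez0_abs ?modz_ge0 ?period_neq0//.
by rewrite abszE ltz_mod// period_neq0.
Qed.

Definition vec_box mu : box := [ffun a => Ordinal (box_index_subproof mu a)].

Lemma vec_boxK mu : congr_vec (box_vec (vec_box mu)) mu.
Proof.
move=> a; rewrite mxE ffunE/= gez0_abs ?modz_ge0 ?period_neq0//.
by rewrite -opprB rpredN {1}(divz_eq (mu a 0) (period a)) addrK dvdz_mull.
Qed.

Lemma box_vec_inj x y : congr_vec (box_vec x) (box_vec y) -> x = y.
Proof.
move=> h; apply/ffunP => a; apply: val_inj => /=.
have := h a; rewrite !mxE -eqz_mod_dvd => /eqP.
rewrite -!(modz_abs _ (period a)) !modz_small ?ltz_nat ?ltn_ord//; first by case.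
Qed.

Lemma sum_classesE (A : set vec) (f : vec -> C) :
  (forall mu nu, congr_vec mu nu -> A mu -> A nu) ->
  (forall mu nu, congr_vec mu nu -> f mu = f nu) ->
  sum_classes k A f = \sum_(x : box | `[< A (box_vec x) >]) f (box_vec x).
Proof.
move=> hA hf; rewrite /sum_classes.
rewrite (@reindex_fsbig _ _ _ _ _ (fun x : box => class_of k (box_vec x))
   [set x | A (box_vec x)]%classic); last first.
  split=> [x Ax|x y _ _ xy|_ [mu Amu <-]]; first by exists (box_vec x).
    apply: box_vec_inj; apply/class_ofP.
    by rewrite xy; apply/class_ofP; exact: congr_vec_refl.
  exists (vec_box mu); last exact/class_of_congr/vec_boxK.
  exact: hA (congr_vec_sym (vec_boxK mu)) Amu.
transitivity (\sum_(x \in [set x : box | A (box_vec x)]%classic) f (box_vec x)).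
  (* The representative picked by [xget] is arbitrary, but f is constant on the class. *)
  apply: eq_fsbigr => x _; apply: esym; apply: hf; apply/class_ofP.
  case: xgetP => [_ -> //|/(_ (box_vec x))] []; apply/class_ofP.
  exact: congr_vec_refl.
rewrite [RHS]bigfs ?index_enum_uniq//; last first.
  by move=> x _; rewrite mem_index_enum.
by apply: eq_fsbigl; apply/seteqP; split=> x /= /asboolP.
Qed.

(** A map s that is an involution modulo the periods permutes the box, after reduction of its values
    to representatives. *)
Lemma sum_box_reindex (s : vec -> vec) (P : pred vec) (f : vec -> C) :
  (forall mu nu, congr_vec mu nu -> congr_vec (s mu) (s nu)) ->
  (forall mu, congr_vec (s (s mu)) mu) ->
  (forall mu nu, congr_vec mu nu -> P mu = P nu) ->
  (forall mu nu, congr_vec mu nu -> f mu = f nu) ->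
  (forall mu, P (s mu) = P mu) ->
  \sum_(x : box | P (box_vec x)) f (box_vec x) =
  \sum_(x : box | P (box_vec x)) f (s (box_vec x)).
Proof.
move=> hs ss hP hf Ps.
rewrite (reindex_inj (h := fun x => vec_box (s (box_vec x)))); last first.
  apply: can_inj (fun x => vec_box (s (box_vec x))) _ => x.
  apply: box_vec_inj; apply: congr_vec_trans (vec_boxK _) _.
  by apply: congr_vec_trans (ss (box_vec x)); apply: hs; exact: vec_boxK.
by apply: eq_big => [x|x _]; rewrite ?(hP _ _ (vec_boxK _)) ?(hf _ _ (vec_boxK _)).
Qed.

End Classes.

(** * Symmetrization over the leaves *)

Section Periodicity.
Variables (R : realType) (k : nat).
Hypothesis k_gt0 : (0 < k)%N.
Local Notation C := R[i].
Local Open Scope complex_scope.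

Let kC0 : k%:R != 0 :> C.
Proof. by rewrite pnatr_eq0 -lt0n. Qed.

Lemma cexp_periodic (z : C) (n : int) :
  cexp (z + (pi : R)%:C * 'i * (2 * n)%:~R) = cexp z.
Proof. by rewrite cexpD cexp_piMi -exprz_exp -exprnP sqrrN expr1n exp1rz mulr1. Qed.

Lemma dsinh_periodic (z : C) (n : int) :
  dsinh (z + (pi : R)%:C * 'i * (2 * n)%:~R) = dsinh z.
Proof.
rewrite /dsinh cexp_periodic opprD.
have -> : - z - pi%:C * 'i * (2 * n)%:~R = - z + pi%:C * 'i * (2 * - n)%:~R :> C.
  by rewrite mulrN intrN mulrN.
by rewrite cexp_periodic.
Qed.

Lemma half_turn_congr (c m m' : int) : c != 0 -> ((2 * k)%:Z * c %| m - m')%Z ->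
  exists n, half_turn R k m / c%:~R =
    half_turn R k m' / c%:~R + (pi : R)%:C * 'i * (2 * n)%:~R.
Proof.
move=> c0 /dvdzP[q E]; exists q.
have c0' : c%:~R != 0 :> C by rewrite intr_eq0.
rewrite -(subrK m' m) E half_turnD /half_turn !intrM -!pmulrn natrM.
by field; rewrite c0' kC0.
Qed.

Variables (I : finType) (w : I -> int).

Lemma leaf_factor_congr i m m' (t : C) : w i != 0 ->
  ((2 * k)%:Z * w i %| m - m')%Z -> leaf_factor k w i m t = leaf_factor k w i m' t.
Proof.
move=> wi0 /(half_turn_congr wi0)[n E].
by rewrite /leaf_factor !mulrBl E addrAC dsinh_periodic.
Qed.

Lemma even_leaf_factor_congr i m m' (t : C) : w i != 0 ->
  ((2 * k)%:Z * w i %| m - m')%Z ->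
  even_leaf_factor k w i m t = even_leaf_factor k w i m' t.
Proof.
move=> wi0 /(half_turn_congr wi0)[n E].
rewrite /even_leaf_factor E opprD cexp_periodic; congr ((_ + _) / 2 * _).
have -> : - (pi%:C * 'i * (2 * n)%:~R) = pi%:C * 'i * (2 * - n)%:~R :> C.
  by rewrite mulrN intrN mulrN.
by rewrite cexp_periodic.
Qed.

Lemma center_factor_congr d m m' (t : C) :
  ((2 * k)%:Z %| m - m')%Z -> center_factor k d m t = center_factor k d m' t.
Proof.
rewrite -[(2 * k)%:Z]mulr1 => /(half_turn_congr (oner_neq0 int))[n].
rewrite rmorph1 !divr1 => E.
by rewrite /center_factor E addrAC dsinh_periodic.
Qed.

(** Modulo 2 pi i the arguments are a + b and -a + b, and sinh(a + b) + sinh(-a + b) = 2 cosh(a)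
    sinh(b). *)
Lemma even_leaf_factor_mean i m m' (t : C) : w i != 0 ->
  ((2 * k)%:Z * w i %| m' + m)%Z ->
  even_leaf_factor k w i m t = (leaf_factor k w i m t + leaf_factor k w i m' t) / 2.
Proof.
rewrite -{1}[m]opprK => wi0 /(half_turn_congr wi0)[n E].
have -> : leaf_factor k w i m' t =
    dsinh (- (half_turn R k m / (w i)%:~R) - t / 2 / (w i)%:~R).
  by rewrite /leaf_factor mulrBl E addrAC dsinh_periodic half_turnN mulNr.
rewrite /leaf_factor mulrBl /even_leaf_factor mulNr /dsinh !opprD !opprK !cexpD.
by field.
Qed.

End Periodicity.

(** * Averaging the sum over the leaf involutions *)

Section Symmetrization.
Variables (R : realType) (V : finType) (G : plumbing V) (k : nat).
Hypothesis hdet : \det (linking G) = 1 \/ \det (linking G) = -1.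
Hypothesis hleaf : forall i, i \in leaves G -> weight G i <= -2.
Hypothesis k_gt0 : (0 < k)%N.
Local Notation C := R[i].
Local Notation vec := 'cV[int]_#|V2 G|.
Local Notation w := (weight G).
Local Notation L a := (leaf_nbrs G (vtx a)).
Implicit Types (mu nu : vec) (a b : 'I_#|V2 G|) (X : {set V}).

Let kC0 : k%:R != 0 :> C.
Proof. by rewrite pnatr_eq0 -lt0n. Qed.

(** The argument of G_v is q = exp(Y / M_v) with Y = [half_turn m - t / 2], so q^c - q^-c is [dsinh]
    at c Y / M_v; the cases c = M_v and c = M_v / w_i occur. *)
Lemma Gfun_vertex_factor (v : V) (m : int) (t : C) :
  Gfun G v (zeta R ((2 * k)%:Z * Mint G v) ^ m * cexp (- t / (2 * (Mint G v)%:~R))) =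
  vertex_factor k w (deg G v) (leaf_nbrs G v) m t.
Proof.
have M0 : (Mint G v)%:~R != 0 :> C by rewrite intr_eq0 (Mint_neq0 hleaf).
set Y := half_turn R k m - t / 2.
have -> : zeta R ((2 * k)%:Z * Mint G v) ^ m * cexp (- t / (2 * (Mint G v)%:~R)) =
    cexp (Y / (Mint G v)%:~R).
  rewrite /zeta /ee -cexpMz -cexpD; congr cexp.
  rewrite /Y /half_turn intrM -pmulrn natrM.
  by field; rewrite M0 kC0.
have qM (c : int) : cexp (Y / (Mint G v)%:~R) ^ c - cexp (Y / (Mint G v)%:~R) ^ (- c) =
    dsinh (c%:~R / (Mint G v)%:~R * Y).
  by rewrite -!cexpMz rmorphN/= mulNr /dsinh mulrCA mulrC -mulrA mulrCA mulrA.
rewrite /Gfun qM divff// mul1r; congr (_ * _); apply: eq_bigr => i iL.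
rewrite qM; congr dsinh.
have w0 : (w i)%:~R != 0 :> C by rewrite intr_eq0 (leaf_weight_neq0 hleaf iL).
have wM : (w i %| Mint G v)%Z by rewrite /Mint (bigD1 i)//= dvdz_mulr.
rewrite -[in X in _ / X](divzK wM) intrM -/Y; field; rewrite w0/=.
apply: contraNneq M0 => z0; by rewrite -(divzK wM) intrM z0 mul0r.
Qed.

(* Multiplication by [u] negates [half_turn m / w i] modulo [2 * pi * 'i] and
   fixes [half_turn m / w j] for the other leaves [j], whenever [k] divides [m]. *)
Lemma flip_exists (v i : V) : i \in leaf_nbrs G v -> exists u : int,
  [/\ (2 %| u - 1)%Z, (4 * Mint G v %| u ^+ 2 - 1)%Z, (2 * w i %| u + 1)%Z &
      forall j, j \in leaf_nbrs G v -> j != i -> (2 * w j %| u - 1)%Z].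
Proof.
move=> iv; pose P := \prod_(j in leaf_nbrs G v | j != i) w j.
have /coprimezP[[x y] /= xy] : coprimez (w i) P.
  by apply: coprimez_prod => j /andP[jv ji]; rewrite (leaf_coprime hdet iv jv)// eq_sym.
have MP : Mint G v = w i * P by rewrite /Mint (bigD1 i).
have yP : y * P = 1 - x * w i by rewrite -xy addrAC subrr add0r.
(* From x w_i + y P = 1 one gets u + 1 = 2x w_i and u - 1 = -2y P, with product -4xy M_v. *)
exists (2 * x * w i - 1); split.
- by apply/dvdzP; exists (x * w i - 1); ring.
- apply/dvdzP; exists (- (x * y)); rewrite MP.
  have -> : - (x * y) * (4 * (w i * P)) = - (4 * x * w i) * (y * P) by ring.
  by rewrite yP; ring.
- by apply/dvdzP; exists x; ring.
move=> j jv ji; have /dvdzP[p pE] : (w j %| P)%Z.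
  by rewrite /P (bigD1 j) ?jv//= dvdz_mulr.
apply/dvdzP; exists (- (y * p)).
have -> : - (y * p) * (2 * w j) = - 2 * (y * (p * w j)) by ring.
by rewrite -pE yP; ring.
Qed.

(** Interpolates between [vertex_factor] for X empty and [even_vertex_factor] for X full, so that
    leaves can be averaged one at a time. *)
Definition mixed_factor X (v : V) (m : int) (t : C) : C :=
  center_factor k (deg G v) m t *
  \prod_(i in leaf_nbrs G v)
     (if (k%:Z %| m)%Z && (i \in X) then even_leaf_factor k w i m t
      else leaf_factor k w i m t).

Definition mixed_term X (t : 'I_#|V2 G| -> C) mu : C :=
  gauss_phase k R mu * \prod_a mixed_factor X (vtx a) (mu a 0) (t a).

Lemma dvdz_congr (c m m' : int) : (c %| m - m')%Z -> (c %| m)%Z = (c %| m')%Z.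
Proof. by move=> h; rewrite -[m in LHS](subrK m' m) rpredDl. Qed.

Lemma dvd_period_k a : (k%:Z %| period k a)%Z.
Proof. by rewrite /period PoszM -mulrA mulrCA dvdz_mulr. Qed.

Lemma mixed_factor_congr X a m m' t : (period k a %| m - m')%Z ->
  mixed_factor X (vtx a) m t = mixed_factor X (vtx a) m' t.
Proof.
move=> h; rewrite /mixed_factor.
rewrite (center_factor_congr k_gt0 _ _ (dvdz_trans (dvdz_mulr _ (dvdzz _)) h)).
rewrite (dvdz_congr (dvdz_trans (dvd_period_k a) h)); congr (_ * _).
apply: eq_bigr => i ia; have wi0 := leaf_weight_neq0 hleaf ia.
have hi : ((2 * k)%:Z * w i %| m - m')%Z.
  apply: dvdz_trans h; rewrite dvdz_mul//.
  by rewrite /Mint (bigD1 i)//= dvdz_mulr.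
by rewrite (leaf_factor_congr k_gt0 _ wi0 hi) (even_leaf_factor_congr k_gt0 _ wi0 hi).
Qed.

Lemma mixed_term_congr X t mu nu :
  congr_vec k mu nu -> mixed_term X t mu = mixed_term X t nu.
Proof.
move=> h; rewrite /mixed_term.
have -> : gauss_phase k R mu = gauss_phase k R nu.
  have -> : mu = nu + (mu - nu) by rewrite addrC subrK.
  by apply: gauss_phase_periodic => // a; have := h a; rewrite !mxE.
by rewrite (eq_bigr _ (fun a _ => mixed_factor_congr X (t a) (h a))).
Qed.

(** Averaging the factor of i replaces each term by the mean of its values at mu and at s mu, where
    s is the involution attached to i. As s permutes the classes, the sum does not change. *)
Lemma sum_mixed_term_add X t (i : V) : i \notin X ->
  \sum_(x : box G k) mixed_term (i |: X) t (box_vec x) =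
  \sum_(x : box G k) mixed_term X t (box_vec x).
Proof.
move=> iX.
have irrel v m s : i \notin leaf_nbrs G v ->
    mixed_factor (i |: X) v m s = mixed_factor X v m s.
  move=> iv; congr (_ * _); apply: eq_bigr => j jv.
  by rewrite in_setU1; case: eqVneq jv iv => // -> ->.
have [/existsP[a ia]|/existsPn nia] := boolP [exists a : 'I_#|V2 G|, i \in L a]; last first.
  apply: eq_bigr => x _; congr (_ * _); apply: eq_bigr => a _; exact: irrel.
have [u [u1 u2 ui uj]] := flip_exists ia.
(* The flip is applied only where k | mu_a; elsewhere s is the identity. *)
pose s mu : vec := \col_b (if b == a then (if (k%:Z %| mu a 0%R)%Z then u else 1) * mu b 0
                           else mu b 0).
have hs mu nu : congr_vec k mu nu -> congr_vec k (s mu) (s nu).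
  move=> h b; rewrite !mxE; case: eqVneq => [->|_]; last exact: h.
  by rewrite (dvdz_congr (dvdz_trans (dvd_period_k a) (h a))) -mulrBr dvdz_mull.
have ss mu : congr_vec k (s (s mu)) mu.
  move=> b; rewrite !mxE eqxx; case: eqVneq => [->|_]; last by rewrite subrr.
  have [km|/negbTE km] := boolP (k%:Z %| mu a 0%R)%Z; last by rewrite mul1r km mul1r subrr.
  (* As k | mu_a and 2 M_v | u^2 - 1, the product (u^2 - 1) mu_a is divisible by the period 2k
     M_v. *)
  rewrite dvdz_mull// mulrA -[X in _ - X]mul1r -mulrBl -expr2.
  have /dvdzP[n ->] := km; rewrite mulrCA; apply: dvdz_mull.
  have -> : period k a = 2 * Mint G (vtx a) * k%:Z by rewrite /period PoszM; ring.
  by apply: dvdz_mul => //; apply: dvdz_trans u2; exact: dvdz_mul.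
have mean mu : mixed_term (i |: X) t mu = (mixed_term X t mu + mixed_term X t (s mu)) / 2.
  have [km|km] := boolP (k%:Z %| mu a 0%R)%Z; last first.
    have -> : s mu = mu.
      by apply/colP => b; rewrite mxE (negbTE km); case: eqP; rewrite ?mul1r.
    rewrite -mulr2n -[X in X / 2]mulr_natr mulfK ?pnatr_eq0//; congr (_ * _).
    apply: eq_bigr => b _; have [ba|ba] := eqVneq b a.
      by rewrite ba /mixed_factor (negbTE km).
    apply: irrel; apply: contraNN ba => ib.
    by rewrite -(inj_eq enum_val_inj) -/(vtx _) (leaf_nbrs_disjoint ib ia).
  have phE : gauss_phase k R (s mu) = gauss_phase k R mu.
    by rewrite -(gauss_phase_scale R hdet hleaf k_gt0 km u1 u2) /s km.
  rewrite /mixed_term phE -mulrDr -mulrA; congr (_ * _).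
  have D Y nu : \prod_b mixed_factor Y (vtx b) (nu b 0) (t b) =
      mixed_factor Y (vtx a) (nu a 0) (t a) *
      \prod_(b | b != a) mixed_factor Y (vtx b) (nu b 0) (t b).
    by rewrite (bigD1 a).
  have sa : s mu a 0 = u * mu a 0 by rewrite mxE eqxx km.
  rewrite !D sa.
  have rest Y : \prod_(b | b != a) mixed_factor Y (vtx b) (s mu b 0) (t b) =
      \prod_(b | b != a) mixed_factor Y (vtx b) (mu b 0) (t b).
    by apply: eq_bigr => b /negbTE ba; rewrite mxE ba.
  rewrite rest -mulrDl [RHS]mulrAC; congr (_ * _); last first.
    apply: eq_bigr => b ba; apply: irrel; apply: contraNN ba => ib.
    by rewrite -(inj_eq enum_val_inj) -/(vtx _) (leaf_nbrs_disjoint ib ia).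
  have wi0 := leaf_weight_neq0 hleaf ia.
  have /dvdzP[n muE] := km.
  have dmul c x : (c %| x)%Z -> (k%:Z * c %| mu a 0%R * x)%Z.
    by move=> cx; rewrite muE mulrAC [_ * k%:Z]mulrC dvdz_mul ?dvdz_mull.
  have umE : u * mu a 0 - mu a 0 = mu a 0 * (u - 1) by ring.
  have kc c : (2 * k)%:Z * c = k%:Z * (2 * c) by rewrite PoszM; ring.
  have kc0 : ((2 * k)%:Z %| u * mu a 0%R - mu a 0%R)%Z.
    by rewrite umE -[(2 * k)%:Z]mulr1 kc mulr1; exact: dmul u1.
  have ki : ((2 * k)%:Z * w i %| u * mu a 0%R + mu a 0%R)%Z.
    have -> : u * mu a 0 + mu a 0 = mu a 0 * (u + 1) by ring.
    by rewrite kc; exact: dmul ui.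
  rewrite /mixed_factor km (dvdz_mull u km) (center_factor_congr k_gt0 _ _ kc0).
  rewrite -mulrDr -mulrA; congr (_ * _).
  (* The factor of i is separated from those of the other leaves at a, which agree at mu_a and at u
     mu_a. *)
  have D' (f : V -> C) : \prod_(j in L a) f j = f i * \prod_(j in L a | j != i) f j.
    by rewrite (bigD1 i).
  rewrite !D' setU11 (negbTE iX) andbF andbT (even_leaf_factor_mean k_gt0 _ wi0 ki).
  set Q := \prod_(j in L a | j != i) _; set Q1 := \prod_(j in L a | j != i) _.
  set Q2 := \prod_(j in L a | j != i) _.
  have -> : Q = Q1.
    by apply: eq_bigr => j /andP[_ /negbTE ji]; rewrite in_setU1 ji.
  have -> : Q2 = Q1.
    apply: eq_bigr => j /andP[jv ji].
    have wj0 := leaf_weight_neq0 hleaf jv.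
    have hj : ((2 * k)%:Z * w j %| u * mu a 0%R - mu a 0%R)%Z.
      by rewrite umE kc; exact: dmul (uj j jv ji).
    by rewrite (leaf_factor_congr k_gt0 _ wj0 hj) (even_leaf_factor_congr k_gt0 _ wj0 hj).
  by rewrite mulrAC mulrDl.
have [S1 S1E S10] : exists2 S1, S1 = \sum_(x : box G k) mixed_term X t (s (box_vec x)) &
    S1 = \sum_(x : box G k) mixed_term X t (box_vec x).
  exists (\sum_(x : box G k) mixed_term X t (s (box_vec x))); first by [].
  apply: esym.
  exact: (sum_box_reindex hleaf k_gt0 (P := xpredT) hs ss (fun _ _ _ => erefl)
    (mixed_term_congr X t) (fun _ => erefl)).
transitivity ((\sum_(x : box G k) mixed_term X t (box_vec x) + S1) / 2).
  by rewrite S1E -big_split mulr_suml; apply: eq_bigr => x _; exact: mean.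
rewrite S10; move: (\sum_(x : box G k) _) => S0; by field.
Qed.

Lemma sum_mixed_term X t :
  \sum_(x : box G k) mixed_term X t (box_vec x) =
  \sum_(x : box G k) mixed_term finset.set0 t (box_vec x).
Proof.
move: {2}#|X| (erefl #|X|) => n; elim: n X => [|n IHn] X.
  by move=> X0; rewrite (cards0_eq X0).
move=> Xn; have [X0|[i iX]] := set_0Vmem X; first by move: Xn; rewrite X0 cards0.
rewrite -(finset.setD1K iX) sum_mixed_term_add ?finset.setD11//; apply: IHn.
by move: Xn; rewrite (cardsD1 i) iX => -[].
Qed.

Lemma sum_even_vertex_factor (t : 'I_#|V2 G| -> C) :
  \sum_(x : box G k) gauss_phase k R (box_vec x) *
    \prod_a vertex_factor k w (deg G (vtx a)) (L a) (box_vec x a 0) (t a) =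
  \sum_(x : box G k) gauss_phase k R (box_vec x) *
    \prod_a even_vertex_factor k w (deg G (vtx a)) (L a) (box_vec x a 0) (t a).
Proof.
transitivity (\sum_(x : box G k) mixed_term finset.set0 t (box_vec x)).
  apply: eq_bigr => x _; congr (_ * _); apply: eq_bigr => a _; congr (_ * _).
  by apply: eq_bigr => i _; rewrite inE andbF.
rewrite -(sum_mixed_term finset.setT).
apply: eq_bigr => x _; congr (_ * _); apply: eq_bigr => a _; congr (_ * _).
by apply: eq_bigr => i _; rewrite inE andbT.
Qed.

End Symmetrization.

(** * Cancellation of the terms divisible by k *)

(** The handshake argument: adding x to the list adds a row and a column with equal sums. *)
Lemma odd_sum_sym (T : Type) (e : rel T) (s : seq T) :
  symmetric e -> irreflexive e -> odd (\sum_(u <- s) \sum_(v <- s) e u v)%N = false.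
Proof.
move=> es ei; elim: s => [|x s IHs]; first by rewrite big_nil.
rewrite big_cons big_cons ei add0n.
under [X in (_ + X)%N]eq_bigr do rewrite big_cons es.
by rewrite big_split/= !oddD IHs addbF addbb.
Qed.

(** * Branches of the tree at a vertex *)

Section Branch.
Variables (V : finType) (G : plumbing V) (v c : V).
Hypothesis vc : adj G v c.

(** The component of c in the tree with v removed, expressed as reachability along edges that avoid
    v. *)
Definition branch : {set V} :=
  [set u | connect (fun x y => [&& adj G x y, x != v & y != v]) c u].

Lemma branch_root : c \in branch.
Proof. by rewrite inE connect0. Qed.

Lemma branch_neq u : u \in branch -> u != v.
Proof.
rewrite inE => /connectP[p]; case/lastP: p => [_ ->|p x].
  by apply: contraTneq vc => /= ->; rewrite adj_irrefl.
by rewrite rcons_path last_rcons => /andP[_ /and3P[_ _ xv]] ->.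
Qed.

(** An edge leaving the branch must end at v. If it started at some u other than c, a simple path
    from c to u would close up through v to a cycle. *)
Lemma branch_edge u w : u \in branch -> w \notin branch -> adj G u w ->
  u = c /\ w = v.
Proof.
move=> ub wb uw; have uv := branch_neq ub.
have wv : w = v.
  apply: contraNeq wb => wv; move: ub; rewrite !inE => ub.
  by apply: connect_trans ub (connect1 _); rewrite uw uv.
split=> //; apply: contraTeq uw => uc; apply/negP; rewrite wv => uw.
move: ub; rewrite inE => /connectP[p ep uE].
case/shortenP: ep uE => p' ep' up' _ uE.
have p'v x : x \in c :: p' -> x != v.
  move=> xp; apply: branch_neq; rewrite inE; exact: (path_connect ep').
apply: (adj_acyclic (p := G) (c := v :: c :: p')).
  by case: p' uE {ep' up' p'v} => [E|//]; rewrite E eqxx in uc.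
rewrite /ucycle/= rcons_path vc/= -uE uw andbT; apply/andP; split.
  by apply: sub_path ep' => x y /and3P[].
rewrite andbC; move: up'; rewrite /= => -> /=.
by apply/negP => /p'v; rewrite eqxx.
Qed.

End Branch.

(** * Cancellation of the constant terms by reflecting a branch *)

Section Vanishing.
Variables (R : realType) (V : finType) (G : plumbing V) (k : nat).
Hypothesis hdet : \det (linking G) = 1 \/ \det (linking G) = -1.
Hypothesis hleaf : forall i, i \in leaves G -> weight G i <= -2.
Hypothesis k_gt0 : (0 < k)%N.
Local Notation C := R[i].
Local Notation vec := 'cV[int]_#|V2 G|.
Local Notation w := (weight G).
Local Notation L a := (leaf_nbrs G (vtx a)).
Local Notation d a := (deg G (vtx a)).
Implicit Types (mu nu : vec) (a b : 'I_#|V2 G|).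

(** The degree counts the neighbours in V2 and the leaves at a, so the leaves cancel modulo 2. *)
Lemma odd_deg_leaf_nbrs a :
  odd (d a + #|L a|) = odd (\sum_(b < #|V2 G|) adj G (vtx a) (vtx b))%N.
Proof.
have -> : (\sum_(b < #|V2 G|) adj G (vtx a) (vtx b) = #|[set u in V2 G | adj G (vtx a) u]|)%N.
  rewrite -sum1dep_card [RHS]big_mkcondr [RHS]big_enum_val.
  by apply: eq_bigr => b _; case: adj.
have -> : (d a = #|[set u in V2 G | adj G (vtx a) u]| + #|L a|)%N.
  rewrite /deg -(cardsID (V2 G)); congr (_ + _)%N; apply: eq_card => u.
    by rewrite !inE andbC.
  rewrite finset.in_setD.
  have [au|au] := boolP (adj G u (vtx a)).
    by rewrite inE adj_sym au andbT (non_V2_leaf au).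
  rewrite inE adj_sym (negbTE au) andbF; apply/esym/negbTE.
  by apply: contra au => /leaf_nbrsP[].
by rewrite -addnA addnn oddD odd_double addbF.
Qed.

(** At t = 0 every [dsinh] is odd in m, and the exponent 2 - e has the parity of e. *)
Lemma vertex_factorN0 (e : nat) (A : {set V}) m :
  vertex_factor k w e A (- m) 0 = (-1) ^+ (e + #|A|) * vertex_factor k w e A m 0 :> C.
Proof.
rewrite /vertex_factor /center_factor /leaf_factor half_turnN mul0r !subr0 dsinhN.
rewrite -[- dsinh _]mulN1r expfzMl exprD mulrACA; congr (_ * _ * _).
  by rewrite expfzDr ?oppr_eq0 ?oner_eq0// -exprnP sqrrN expr1n mul1r -exprz_inv invrN1.
rewrite -prodrN; apply: eq_bigr => i _.
by rewrite mulNr dsinhN.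
Qed.

(** In the situation of (2), the value of the averaged vertex factor at t_v = 0 after its removable
    singularity is filled in. *)
Definition value0 a (m : int) : C :=
  if (k%:Z %| m)%Z && (L a != finset.set0) then 0 else vertex_factor k w (d a) (L a) m 0.

Lemma value0_congr a m m' : (period k a %| m - m')%Z -> value0 a m = value0 a m'.
Proof.
move=> h; rewrite /value0 (dvdz_congr (dvdz_trans (dvd_period_k k a) h)).
case: ifP => // _; have := mixed_factor_congr hleaf k_gt0 finset.set0 (0 : C) h.
rewrite /mixed_factor /vertex_factor.
under eq_bigr do rewrite inE andbF.
by under [in X in _ = X -> _]eq_bigr do rewrite inE andbF.
Qed.

Lemma value0N a m : value0 a (- m) = (-1) ^+ (d a + #|L a|) * value0 a m.
Proof. by rewrite /value0 rpredN; case: ifP => _; rewrite ?mulr0// vertex_factorN0. Qed.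

Definition term0 mu : C := gauss_phase k R mu * \prod_a value0 a (mu a 0).

Lemma term0_congr mu nu : congr_vec k mu nu -> term0 mu = term0 nu.
Proof.
move=> h; rewrite /term0.
have -> : gauss_phase k R mu = gauss_phase k R nu.
  have -> : mu = nu + (mu - nu) by rewrite addrC subrK.
  by apply: gauss_phase_periodic => // a; have := h a; rewrite !mxE.
by rewrite (eq_bigr _ (fun a _ => value0_congr (h a))).
Qed.

Definition zero_set mu : {set 'I_#|V2 G|} := [set a | (k%:Z %| mu a 0%R)%Z].

Lemma zero_set_congr mu nu : congr_vec k mu nu -> zero_set mu = zero_set nu.
Proof.
move=> h; apply/setP => a; rewrite !inE.
exact: dvdz_congr (dvdz_trans (dvd_period_k k a) (h a)).
Qed.

(** Fix z in B. If z has a leaf, every term is zero. Otherwise reflecting mu on a branch at z keeps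
    the zero set and the phase and reverses the sign of the product, so the sum equals its own
    negative. Since the zero set is kept, the cancellation takes place for each B separately. *)
Lemma sum_term0_zero_set (B : {set 'I_#|V2 G|}) : B != finset.set0 ->
  \sum_(x : box G k | zero_set (box_vec x) == B) term0 (box_vec x) = 0.
Proof.
move=> /set0Pn[z zB].
have kz mu : zero_set mu == B -> (k%:Z %| mu z 0%R)%Z.
  by move=> /eqP muB; move: zB; rewrite -muB inE.
have [Lz|Lz] := eqVneq (L z) finset.set0; last first.
  apply: big1 => x /kz kx.
  by rewrite /term0 (bigD1 z)//= /value0 kx Lz mul0r mulr0.
have [cv zc] : exists cv, adj G (vtx z) cv.
  have : (0 < d z)%N by have := vtx_V2 z; rewrite inE; exact: ltnW.
  by case/card_gt0P => cv; rewrite inE; exists cv.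
have cvV2 : cv \in V2 G.
  have cz : adj G cv (vtx z) by rewrite adj_sym.
  by apply/negPn; rewrite (non_V2_leaf cz) Lz inE.
have [c cE] : exists c : 'I_#|V2 G|, vtx c = cv.
  by exists (enum_rank_in cvV2 cv); rewrite /vtx enum_rankK_in.
pose A a := vtx a \in branch G (vtx z) cv.
have Ac : A c by rewrite /A cE branch_root.
have Az : ~~ A z by apply/negP => /(branch_neq zc); rewrite eqxx.
have Aedge a b : A a -> ~~ A b -> adj G (vtx a) (vtx b) -> a = c /\ b = z.
  move=> Aa Ab /(branch_edge zc Aa Ab)[ac bz].
  by split; apply: enum_val_inj; rewrite // -[LHS]/(vtx a) ac -cE.
have cz : adj G (vtx c) (vtx z) by rewrite cE adj_sym.
have parity : odd (\sum_(a | A a) (d a + #|L a|))%N.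
  have -> : odd (\sum_(a | A a) (d a + #|L a|)) =
      odd (\sum_(a | A a) \sum_(b < #|V2 G|) adj G (vtx a) (vtx b)).
    elim/big_rec2: _ => // a x y _ xy; by rewrite !(oddD _ x, oddD _ y) odd_deg_leaf_nbrs xy.
  (* Adjacent pairs inside the branch are even in number by symmetry; the only other pair is (c,
     z). *)
  have -> : (\sum_(a | A a) \sum_(b < #|V2 G|) adj G (vtx a) (vtx b) =
      \sum_(a | A a) \sum_(b | A b) adj G (vtx a) (vtx b) + 1)%N.
    under eq_bigr do rewrite (bigID A).
    rewrite big_split/=; congr (_ + _)%N.
    rewrite (bigD1 c)//= (bigD1 z)//= cz !big1// => [a /andP[Aa ac]|b /andP[Ab bz]].
      rewrite big1// => b Ab; case: (boolP (adj _ _ _)) => // ab.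
      by have [aE _] := Aedge _ _ Aa Ab ab; rewrite aE eqxx in ac.
    case: (boolP (adj _ _ _)) => // ab.
    by have [_ bE] := Aedge _ _ Ac Ab ab; rewrite bE eqxx in bz.
  rewrite addn1 /= -big_filter.
  under eq_bigr do rewrite -big_filter.
  rewrite (@odd_sum_sym _ (fun a b => adj G (vtx a) (vtx b)))//.
    by move=> a b; exact: adj_sym.
  by move=> a; exact: adj_irrefl.
pose s mu : vec := \col_b (if A b then - mu b 0 else mu b 0).
have hs mu nu : congr_vec k mu nu -> congr_vec k (s mu) (s nu).
  by move=> h b; rewrite !mxE; case: ifP => _ //; rewrite -opprD rpredN.
have ss mu : congr_vec k (s (s mu)) mu.
  by move=> b; rewrite !mxE; case: (A b); rewrite ?opprK subrr dvdz0.
have zs mu : zero_set (s mu) = zero_set mu.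
  by apply/setP => b; rewrite !inE mxE; case: ifP; rewrite ?rpredN.
have anti mu : zero_set mu == B -> term0 (s mu) = - term0 mu.
  move=> /kz kmu; rewrite /term0.
  rewrite (gauss_phase_reflect R hdet hleaf k_gt0 Ac Az cz Aedge kmu) -mulrN.
  congr (_ * _).
  have sE a : value0 a (s mu a 0) =
      (if A a then (-1) ^+ (d a + #|L a|) else 1) * value0 a (mu a 0).
    by rewrite mxE; case: ifP => _; rewrite ?mul1r// value0N.
  rewrite (eq_bigr _ (fun a _ => sE a)) big_split/= -big_mkcond/=.
  by rewrite -expr_sum -signr_odd parity expr1 mulN1r.
pose P mu := zero_set mu == B.
have hP mu nu : congr_vec k mu nu -> P mu = P nu.
  by move=> h; rewrite /P (zero_set_congr h).
have Ps mu : P (s mu) = P mu by rewrite /P zs.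
have E : \sum_(x : box G k | P (box_vec x)) term0 (box_vec x) =
    - \sum_(x : box G k | P (box_vec x)) term0 (box_vec x).
  rewrite -sumrN; apply: etrans (sum_box_reindex hleaf k_gt0 hs ss hP term0_congr Ps) _.
  by apply: eq_bigr => x; exact: anti.
have eqN0 (x : C) : x = - x -> x = 0.
  by move/eqP; rewrite -addr_eq0 -mulr2n mulrn_eq0 => /eqP.
exact: eqN0 E.
Qed.

End Vanishing.

(** * Order and value of F *)

Lemma near_forall (K : numFieldType) (V : normedModType K) (x : V) (P : set V) :
  (forall t, P t) -> (\forall t \near x, P t)%classic.
Proof. by move=> PT; apply: nearW. Qed.

(** Used to show that a function does not vanish near 0, or near 0 on a hyperplane, by evaluating it
    along one line. *)
Lemma near0_line (K : numFieldType) (V : normedModType K) (v : V) (P : set V) :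
  (\forall t \near (0 : V), P t)%classic -> exists2 e : K, e != 0 & P (e *: v).
Proof.
move=> P0.
have P0' : nbhs ((0 : K) *: v) P by rewrite scale0r.
have : (\forall e \near (0 : K)^', e != 0 /\ P (e *: v))%classic.
  near=> e; split; near: e; first exact: nbhs_dnbhs_neq.
  by apply: nbhs_dnbhs; exact: (@scalel_continuous K V v (0 : K) P P0').
by case/filter_ex => e [e0 Pe]; exists e.
Unshelve. all: by end_near. Qed.

Section Assembly.
Variables (R : realType) (V : finType) (G : plumbing V) (k : nat).
Hypothesis hdet : \det (linking G) = 1 \/ \det (linking G) = -1.
Hypothesis hleaf : forall i, i \in leaves G -> weight G i <= -2.
Hypothesis k_gt0 : (0 < k)%N.
Local Notation C := R[i].
Local Notation vec := 'cV[int]_#|V2 G|.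
Local Notation w := (weight G).
Local Notation L a := (leaf_nbrs G (vtx a)).
Local Notation d a := (deg G (vtx a)).
Local Notation space := 'rV[R[i]^o]_#|V2 G|.
Implicit Types (mu nu : vec) (a b : 'I_#|V2 G|).

Lemma Ffun_box (t : space) : Ffun k t = prefactor G k R *
  \sum_(x : box G k) gauss_phase k R (box_vec x) *
    \prod_a even_vertex_factor k w (d a) (L a) (box_vec x a 0) (t 0 a).
Proof.
rewrite /Ffun; congr (_ * _).
rewrite -(sum_even_vertex_factor hdet hleaf k_gt0 (fun a => t 0 a)).
pose f mu := gauss_phase k R mu *
    \prod_a vertex_factor k w (d a) (L a) (mu a 0) (t 0 a).
have fE : f = mixed_term k finset.set0 (fun a => t 0 a).
  apply/funext => mu; congr (_ * _); apply: eq_bigr => a _; congr (_ * _).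
  by apply: eq_bigr => i _; rewrite inE andbF.
transitivity (sum_classes k setT f).
  congr (sum_classes k _ _); apply/funext => mu; congr (_ * _).
  by apply: eq_bigr => a _; exact: Gfun_vertex_factor.
have hf mu nu : congr_vec k mu nu -> f mu = f nu.
  by rewrite fE; exact: mixed_term_congr.
apply: etrans (sum_classesE hdet hleaf k_gt0 (A := setT) (fun _ _ _ => id) hf) _.
by apply: eq_bigl => x; apply/asboolP.
Qed.

Lemma F0_rhs_box : F0_rhs G k R = prefactor G k R *
  \sum_(x : box G k | zero_set k (box_vec x) == finset.set0) term0 R k (box_vec x).
Proof.
rewrite /F0_rhs; congr (_ * _).
pose f mu := gauss_phase k R mu *
    \prod_a vertex_factor k w (d a) (L a) (mu a 0) (0 : C).
have fE : f = mixed_term k finset.set0 (fun=> 0).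
  apply/funext => mu; congr (_ * _); apply: eq_bigr => a _; congr (_ * _).
  by apply: eq_bigr => i _; rewrite inE andbF.
set A := (X in sum_classes k X _).
transitivity (sum_classes k A f).
  congr (sum_classes k _ _); apply/funext => mu; congr (_ * _).
  apply: eq_bigr => a _; rewrite -(Gfun_vertex_factor hleaf k_gt0).
  by rewrite oppr0 mul0r cexp0 mulr1.
have zA mu : (zero_set k mu == finset.set0) = `[< A mu >].
  apply/eqP/asboolP => [z0 a|Amu].
    have : a \notin zero_set k mu by rewrite z0 inE.
    by rewrite inE.
  by apply/setP => a; rewrite !inE; apply/negbTE/Amu.
have hf mu nu : congr_vec k mu nu -> f mu = f nu.
  by rewrite fE; exact: mixed_term_congr.
have hA mu nu : congr_vec k mu nu -> A mu -> A nu.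
  move=> h Amu; apply/asboolP; rewrite -zA -(zero_set_congr h) zA.
  exact/asboolP.
apply: etrans (sum_classesE hdet hleaf k_gt0 hA hf) _.
apply: eq_big => [x|x Ax]; first by rewrite zA.
rewrite /f /term0; congr (_ * _); apply: eq_bigr => a _.
(* No coordinate is divisible by k here, so [value0] is the plain vertex factor. *)
by rewrite /value0 (negbTE (asboolW Ax a)).
Qed.

Let e a : int := Num.min 0 (2 - (d a)%:Z + #|L a|%:Z).

(** Stated as a sigma type so that the holomorphic factor can be chosen as a function of the vertex
    and of m. The exponent [e a] is common to all m and can be taken out of the sum. *)
Lemma vertex_series a m : { phi : C -> C | [/\ diff_near (0 : C^o) phi,
    forall t, t != 0 -> even_vertex_factor k w (d a) (L a) m t = t ^ e a * phi t &
    e a = 0 -> (d a = 2%N) \/ (0 < 2 - (d a)%:Z + #|L a|%:Z) ->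
    phi 0 = value0 R k a m] }.
Proof.
apply: cid; apply: even_vertex_factor_order => //.
  by have := vtx_V2 a; rewrite inE.
by move=> i; exact: leaf_weight_neq0.
Qed.

Let phi a m := sval (vertex_series a m).

Definition regular_part (t : space) : C := prefactor G k R *
  \sum_(x : box G k) gauss_phase k R (box_vec x) *
    \prod_a phi a (box_vec x a 0) (t 0 a).

Lemma diff_near_coord (f : C -> C) a :
  diff_near (0 : C^o) f -> diff_near (0 : space) (fun t => f (t 0 a)).
Proof.
move=> df; apply: (@diff_near_comp _ _ _ (0 : space) (fun t => t 0 a : C^o) f).
  by move=> t; exact: differentiable_coord.
by rewrite mxE.
Qed.

Lemma holomorphic_regular_part : holomorphic0 regular_part.
Proof.
apply: (@diff_nearM _ _ (0 : space) (fun=> prefactor G k R)); first exact: diff_near_cst.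
apply: diff_near_sum => x _.
apply: (@diff_nearM _ _ (0 : space) (fun=> gauss_phase k R (box_vec x))).
  exact: diff_near_cst.
apply: diff_near_prod => a _; apply: diff_near_coord.
by case: (svalP (vertex_series a (box_vec x a 0))).
Qed.

Lemma Ffun_regular_part (t : space) : (forall a, t 0 a != 0) ->
  Ffun k t = \prod_a (t 0 a : C) ^ e a * regular_part t.
Proof.
move=> t0; rewrite Ffun_box /regular_part mulrCA; congr (_ * _).
rewrite mulr_sumr; apply: eq_bigr => x _; rewrite mulrCA; congr (_ * _).
rewrite -big_split/=; apply: eq_bigr => a _.
by case: (svalP (vertex_series a (box_vec x a 0))) => _ ->.
Qed.

Definition all_coords (t : space) : C := \prod_a (t 0 a : C).

Lemma holomorphic_monomial (n : 'I_#|V2 G| -> nat) (P : pred 'I_#|V2 G|) :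
  holomorphic0 (fun t : space => \prod_(a | P a) (t 0 a : C) ^+ n a).
Proof.
apply: (@diff_near_prod _ _ (0 : space) _ _ P (fun a t => (t 0 a : C) ^+ n a)) => a _.
apply: (@diff_near_coord (fun z => z ^+ n a)).
apply: diff_nearX; apply: diff_nearW => z.
by apply/derivable1_diffP; exact: derivable_id.
Qed.

(** The exceptional analytic set is the union of the coordinate hyperplanes, cut out by the product
    of all coordinates. *)
Lemma germ_eq_off_coords (f g : space -> C) :
  (forall t : space, (forall a, t 0 a != 0) -> f t = g t) -> germ_eq f g.
Proof.
move=> fg; exists all_coords; split.
- exact: (holomorphic_monomial (fun=> 1%N) xpredT).
- move=> /(near0_line (const_mx 1))[z z0 /eqP]; apply/negP.
  by apply/prodf_neq0 => a _; rewrite !mxE mulr1.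
- by apply: (@near_forall _ space) => t /prodf_neq0 t0; apply: fg => a; exact: t0.
Qed.

Lemma ord_along_Ffun a : (((e a)%:~R : R)%:E <= ord_along a (@Ffun V G k R))%E.
Proof.
apply: ereal_sup_ubound; exists (e a) => //=.
(* The possible poles along the other hyperplanes go into the denominator. *)
exists regular_part, (fun t : space => \prod_(b | b != a) (t 0 b : C) ^+ `|e b|%N).
split; first exact: holomorphic_regular_part.
- exact: holomorphic_monomial.
(* The test direction has t_a = 0 and all other coordinates 1, so the denominator is nonzero along
   it. *)
- move=> /(near0_line (\row_b (b != a)%:R))[z z0].
  rewrite !mxE eqxx mulr0 => /(_ erefl)/eqP; apply/negP.
  by apply/prodf_neq0 => b ba; rewrite !mxE ba mulr1 expf_neq0.
apply: germ_eq_off_coords => t t0; rewrite (Ffun_regular_part t0) (bigD1 a)//= -mulrA.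
congr (_ * _); rewrite mulrC; congr (_ * _); rewrite -prodfV; apply: eq_bigr => b _.
have -> : e b = - `|e b|%N%:Z by rewrite /e; lia.
by rewrite -exprnN abszN absz_nat.
Qed.

(** All exponents being 0, F is the germ of [regular_part]. Its value at 0 is the sum of all
    [term0]; grouped by zero set, only the terms with no coordinate divisible by k survive. *)
Lemma holomorphic_with_value_Ffun :
  (forall a, e a = 0) -> (forall a, d a = 2%N \/ 0 < 2 - (d a)%:Z + #|L a|%:Z) ->
  holomorphic_with_value (@Ffun V G k R) (F0_rhs G k R).
Proof.
move=> e0 hd; exists regular_part; split; first exact: holomorphic_regular_part.
  apply: germ_eq_off_coords => t t0; rewrite (Ffun_regular_part t0) big1 ?mul1r// => a _.
  by rewrite e0 expr0z.
rewrite F0_rhs_box /regular_part; congr (_ * _).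
transitivity (\sum_(x : box G k) term0 R k (box_vec x)).
  apply: eq_bigr => x _; congr (_ * _); apply: eq_bigr => a _.
  rewrite [X in phi _ _ X]mxE /phi.
  by case: (svalP (vertex_series a (box_vec x a 0))) => _ _ ->.
rewrite (partition_big (fun x : box G k => zero_set k (box_vec x)) xpredT)//=.
rewrite (bigD1 finset.set0)//= [X in _ + X]big1 ?addr0// => B B0.
exact: sum_term0_zero_set.
Qed.

End Assembly.

Theorem proposition6p1 (R : realType) (V : finType) (G : plumbing V)
  (hV : (2 <= #|V|)%N)
  (hneg : negative_definite R (linking G))
  (hdet : \det (linking G) = 1 \/ \det (linking G) = -1)
  (hleaf : forall i, i \in leaves G -> weight G i <= -2)
  (k : nat) (hk : (0 < k)%N) :
  (forall a : 'I_#|V2 G|, (3 <= deg G (vtx a))%N ->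
     ((Num.min 0 (#|leaf_nbrs G (vtx a)|%:Z + 2 - (deg G (vtx a))%:Z))%:~R%:E
        <= ord_along a (@Ffun V G k R))%E)
  /\
  ((forall v : V, (3 <= deg G v)%N ->
      0 < #|leaf_nbrs G v|%:Z + 2 - (deg G v)%:Z) ->
   holomorphic_with_value (@Ffun V G k R) (F0_rhs G k R)).
Proof.
have perm a : #|leaf_nbrs G (vtx a)|%:Z + 2 - (deg G (vtx a))%:Z =
    2 - (deg G (vtx a))%:Z + #|leaf_nbrs G (vtx a)|%:Z by lia.
split=> [a _|hG]; first by rewrite perm; exact: ord_along_Ffun.
(* The hypothesis of (2) concerns degree at least 3. A vertex of degree 2 has exponent |leaves at v|
   >= 0 and hence no pole either. *)
have hd (a : 'I_#|V2 G|) : deg G (vtx a) = 2%N \/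
    0 < 2 - (deg G (vtx a))%:Z + #|leaf_nbrs G (vtx a)|%:Z.
  have := vtx_V2 a; rewrite inE leq_eqVlt => /orP[/eqP <-|d3]; first by left.
  by right; rewrite -perm; exact: hG.
have e0 (a : 'I_#|V2 G|) :
    Num.min 0 (2 - (deg G (vtx a))%:Z + #|leaf_nbrs G (vtx a)|%:Z) = 0.
  by case: (hd a) => [->|]; lia.
exact: holomorphic_with_value_Ffun.
Qed.
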